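(* Fix $H$ and $\Lambda$. Let $f(n)$ be a positive function with $f(n)=\omega(1)$ (that is, $f(n)\to\infty$ as $n\to\infty$). There is a positive function $g(n)$ with $g(n)=o(1)$ as $n\to\infty$ (depending on $f$, as well as on $H$ and $\Lambda$) such that the following holds for every sequence $\{G^n\}_{n=1}^{\infty}$ with each $G^n$ an $n$-regular bipartite graph and every $p=p(n)\in[0,1]$. Below, $\varphi$ denotes a random element of ${\rm Hom}(G^n_p,H)$ chosen according to $p_\Lambda$, and $\bar p_\Lambda(k)$ is computed with respect to the graph $G^n_p$. (1) If $p \geq f(n)/n$, then with probability at least $1-g(n)$ the random graph $G^n_p$ satisfies that for each $k \in V(H)$, $$p_\Lambda\left(s(k,\varphi) \in I_k(g(n))\right) \leq g(n)\quad\text{and}\quad \bar{p}_\Lambda(k) \in \left[a^-_\Lambda(k)-g(n),\, a^+_\Lambda(k)+g(n)\right].$$ (2) If $p \leq 1/(f(n)n)$, then with probability at least $1-g(n)$ the random graph $G^n_p$ satisfies that for each $k \in V(H)$, $$p_\Lambda\left(\left|s(k,\varphi) - \frac{\lambda_k}{w_\Lambda(H)}\right| \leq g(n)\right) \geq 1 - g(n)\quad\text{and}\quad \left|\bar{p}_\Lambda(k) - \frac{\lambda_k}{w_\Lambda(H)}\right| \leq g(n).$$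
   Context: Graphs $G$ (in particular the $G^n$) are simple, loopless and finite; $H$ is a finite graph without multiple edges but perhaps with loops, having at least one edge (possibly a loop); $\Lambda=\{\lambda_i : i\in V(H)\}$ is a set of positive real weights indexed by the vertices of $H$. For a graph $G$ and $0\le p\le1$, $G_p$ is the random subgraph of $G$ (on the same vertex set) obtained by deleting each edge independently with probability $1-p$. An $H$-colouring of $G$ is a function $\varphi:V(G)\to V(H)$ such that $uv\in E(G)$ implies $\varphi(u)\varphi(v)\in E(H)$; ${\rm Hom}(G,H)$ is the set of these. Put $w_\Lambda(\varphi)=\prod_{v\in V(G)}\lambda_{\varphi(v)}$, $Z_\Lambda(G,H)=\sum_{\varphi\in{\rm Hom}(G,H)}w_\Lambda(\varphi)$, and let $p_\Lambda$ be the probability distribution on ${\rm Hom}(G,H)$ with $p_\Lambda(\varphi)=w_\Lambda(\varphi)/Z_\Lambda(G,H)$. For $\varphi \in {\rm Hom}(G,H)$ and $k\in V(H)$ let $s(k,\varphi)=|\varphi^{-1}(k)|/|V(G)|$ and let $\bar p_\Lambda(k)=\frac{1}{|V(G)|}\sum_{v\in V(G)}p_\Lambda(\varphi(v)=k)$, the expectation of $s(k,\varphi)$ under $p_\Lambda$. For $A,B\subseteq V(H)$ write $A\sim B$ if $uv\in E(H)$ for all $u\in A$, $v\in B$. Let $w_\Lambda(A)=\sum_{i\in A}\lambda_i$, $w_\Lambda(H)=w_\Lambda(V(H))$, $\eta_\Lambda(H)=\max\{w_\Lambda(A)w_\Lambda(B):A\sim B\}$, and $\mathcal{M}_\Lambda(H)=\{(A,B):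 A,B\subseteq V(H),\ A\sim B,\ w_\Lambda(A)w_\Lambda(B)=\eta_\Lambda(H)\}$. For $k\in V(H)$ let $$a_\Lambda^+(k)=\frac{\max\{w_\Lambda(A)\lambda_k\mathbf{1}_{\{k\in B\}}+w_\Lambda(B)\lambda_k\mathbf{1}_{\{k\in A\}}:(A,B)\in\mathcal{M}_\Lambda(H)\}}{2\eta_\Lambda(H)},$$ and let $a_\Lambda^-(k)$ be defined in the same way with $\max$ replaced by $\min$. For $\varepsilon>0$ let $I_k(\varepsilon)=[0,a_\Lambda^-(k)-\varepsilon)\cup(a_\Lambda^+(k)+\varepsilon,1]$ (an interval whose endpoints are out of order is empty). *)

(* Defs.v *)
From mathcomp Require Import all_boot all_order all_algebra.
From mathcomp Require Import classical_sets reals topology normedtype sequences.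

Set Implicit Arguments.
Unset Strict Implicit.
Unset Printing Implicit Defensive.

Import Order.TTheory GRing.Theory Num.Theory.

Local Open Scope ring_scope.

(* Finite, without multiple edges; loops are allowed. *)
Record graph := Graph {
  vertex :> finType;
  adj : rel vertex;
  adj_sym : symmetric adj }.

Definition has_edge (H : graph) : Prop := exists i j : H, adj i j.

Definition loopless (G : graph) : Prop := irreflexive (@adj G).

Definition bipartite (G : graph) : Prop :=
  exists c : G -> bool, forall u v : G, adj u v -> c u != c v.

Definition regular (n : nat) (G : graph) : Prop :=
  forall u : G, #|[set v : G | adj u v]| = n.

Section RandomSubgraph.
Variables (R : realType) (G : graph).

Definition edges : {set {set G}} :=
  [set [set uv.1; uv.2] | uv in [pred uv : G * G | adj uv.1 uv.2]].

Definition subadj (F : {set {set G}}) : rel G :=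
  fun u v => adj u v && ([set u; v] \in F).

Lemma subadj_sym F : symmetric (subadj F).
Proof. by move=> u v; rewrite /subadj adj_sym finset.setUC. Qed.

Definition subgraph (F : {set {set G}}) : graph := Graph (subadj_sym F).

(* Probability that the set of retained edges of G_p is F (for F \subset edges):
   each edge is independently retained with probability p. *)
Definition edge_law (p : R) (F : {set {set G}}) : R :=
  \prod_(e in edges) (if e \in F then p else 1 - p).

Definition prob_subgraph (p : R) (E : graph -> bool) : R :=
  \sum_(F : {set {set G}} | (F \subset edges) && E (subgraph F)) edge_law p F.

End RandomSubgraph.

Section Colourings.
Variables (R : realType) (G H : graph) (lam : H -> R).

Definition Hom : {set {ffun G -> H}} :=
  [set phi : {ffun G -> H} |
    [forall u, forall v, adj u v ==> adj (phi u) (phi v)]].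

Definition col_weight (phi : {ffun G -> H}) : R := \prod_(v : G) lam (phi v).

Definition Zpart : R := \sum_(phi in Hom) col_weight phi.

Definition p_mass (phi : {ffun G -> H}) : R := col_weight phi / Zpart.

Definition p_prob (E : pred {ffun G -> H}) : R :=
  \sum_(phi in Hom | E phi) p_mass phi.

Definition col_share (k : H) (phi : {ffun G -> H}) : R :=
  #|[set v : G | phi v == k]|%:R / #|G|%:R.

Definition p_bar (k : H) : R :=
  #|G|%:R^-1 * \sum_(v : G) p_prob (fun phi => phi v == k).

End Colourings.

(* Only meaningful for nonempty lists: the unit of the big operator is then an
   element of the list, so it does not affect the extremum.  The lists used below
   are nonempty, since (set0, set0) is always joined and the maximum is attained. *)
Definition list_max (R : realType) (s : seq R) : R :=
  \big[Num.max/head 0 s]_(x <- s) x.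
Definition list_min (R : realType) (s : seq R) : R :=
  \big[Num.min/head 0 s]_(x <- s) x.

Section Weights.
Variables (R : realType) (H : graph) (lam : H -> R).

Definition joined (A B : {set H}) : bool :=
  [forall u in A, forall v in B, adj u v].

Definition set_weight (A : {set H}) : R := \sum_(i in A) lam i.

Definition total_weight : R := set_weight [set: H].

Definition eta : R :=
  list_max [seq set_weight AB.1 * set_weight AB.2
           | AB in [set AB : {set H} * {set H} | joined AB.1 AB.2]].

Definition opt_pairs : {set {set H} * {set H}} :=
  [set AB : {set H} * {set H} |
    joined AB.1 AB.2 && (set_weight AB.1 * set_weight AB.2 == eta)].

Definition pair_value (k : H) (AB : {set H} * {set H}) : R :=
  set_weight AB.1 * lam k * (k \in AB.2)%:R
  + set_weight AB.2 * lam k * (k \in AB.1)%:R.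

Definition a_plus (k : H) : R :=
  list_max [seq pair_value k AB | AB in opt_pairs] / (2 * eta).

Definition a_minus (k : H) : R :=
  list_min [seq pair_value k AB | AB in opt_pairs] / (2 * eta).

Definition in_I (k : H) (eps x : R) : bool :=
  (x \in `[0, a_minus k - eps[) || (x \in `]a_plus k + eps, 1]).

End Weights.

(* Main.v *)
Require Import Defs.
From mathcomp Require Import all_boot all_order all_algebra.
From mathcomp Require Import boolp classical_sets reals topology normedtype sequences exp.
From mathcomp Require Import lra ring.

(** The share of the colour [k] is controlled by tilting: multiplying the activity
    of [k] by [1 + s] turns the partition function into the generating function of
    the number of vertices of colour [k], so a bound
    [Z(tilted) <= Z * expR (N * (s * a + O(s ^ 2) + o(1)))] on a graph with [N]
    vertices gives, by Markov's inequality with a small fixed [s] of either sign,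
    that the share exceeds [a + eps] (for [s > 0]) or falls below [a - eps]
    (for [s < 0]) with probability exponentially small in [N] ([tilt_tail]).  As
    [N >= n], everything reduces to estimates of partition functions up to factors
    [expR (o(N))].

    In the dense regime all but a few vertices of the percolated graph have degree
    close to [D], where [D] is about [n * p] and tends to infinity.  For a bipartite
    graph with classes of size [m], colouring the classes from an optimal pair gives
    [Z >= eta ^ m].  Conversely, average out the colours of one class: [Z] becomes
    the mean, over independent colours on the other class, of a product of factors,
    one for each averaged vertex [y] and depending on the colours around [y].  After
    dropping some edges every coordinate occurs in at most [D] factors, and Finner's
    inequality ([finner]) bounds the mean of the product by the product of the
    [D]-norms.  A union bound over the set [T] of colours seen by [y] shows that each
    norm is at most [eta], up to a factor [1 + O(1 / D)] and a bounded factor to the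
    power [(D - deg y) / D]; the outcome is [bipartite_Zpart_le].  It applies to the
    tilted activities as well, and the first-order expansion of the tilted [eta],
    with one-sided slopes given by [a_plus] and [a_minus], yields the bound above
    ([tilted_optimum], [dense_tail]).

    In the sparse regime almost all vertices are isolated, so both partition
    functions agree with powers of the total weight up to [expR (o(N))], and
    [a = lam k / total_weight lam] ([sparse_tail]).

    The two properties of the percolated graph that are used, a small sum of the
    [`|deg v - D|] and a small sum of the degrees respectively, hold with high
    probability by the first two moments of the degrees and Markov's inequality.
    All estimates are uniform in the graph and in [p], and a diagonal choice turns
    the resulting thresholds into a function [g]. *)

Set Implicit Arguments.
Unset Strict Implicit.
Unset Printing Implicit Defensive.

Import Order.TTheory GRing.Theory Num.Theory.
Import numFieldNormedType.Exports.

Local Open Scope ring_scope.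

(** * Product measures on colourings *)

Section ProductMean.
Variables (R : realType) (I T : finType) (q : T -> R).
Hypotheses (q_ge0 : forall k, 0 <= q k) (q_sum : \sum_k q k = 1).

Implicit Types (phi : {ffun I -> T}) (F : {ffun I -> T} -> R).

Definition mean F : R := \sum_(phi : {ffun I -> T}) (\prod_v q (phi v)) * F phi.

Definition upd phi (x : I) (k : T) : {ffun I -> T} :=
  [ffun v => if v == x then k else phi v].

Definition resample (x : I) F phi : R := \sum_k q k * F (upd phi x k).

Definition ignores F (x : I) := forall phi k, F (upd phi x k) = F phi.

Lemma eq_mean F F' : F =1 F' -> mean F = mean F'.
Proof. by move=> e; apply: eq_bigr => phi _; rewrite e. Qed.

Lemma prod_q_ge0 phi : 0 <= \prod_v q (phi v).
Proof. exact: prodr_ge0. Qed.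

Lemma le_mean F F' : (forall phi, F phi <= F' phi) -> mean F <= mean F'.
Proof.
by move=> le; apply: ler_sum => phi _; apply: ler_wpM2l; rewrite ?prod_q_ge0.
Qed.

Lemma mean_sum (J : finType) (P : pred J) (F : J -> {ffun I -> T} -> R) :
  mean (fun phi => \sum_(j | P j) F j phi) = \sum_(j | P j) mean (F j).
Proof.
by rewrite exchange_big; apply: eq_bigr => phi _; rewrite mulr_sumr.
Qed.

Lemma meanZr a F : mean (fun phi => F phi * a) = mean F * a.
Proof. by rewrite mulr_suml; apply: eq_bigr => phi _; rewrite mulrA. Qed.

Lemma mean_prod (h : I -> T -> R) :
  mean (fun phi => \prod_v h v (phi v)) = \prod_v \sum_k q k * h v k.
Proof.
rewrite bigA_distr_bigA; apply: eq_bigr => phi _.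
by rewrite -big_split.
Qed.

Lemma mean1 : mean (fun=> 1) = 1.
Proof.
transitivity (mean (fun phi => \prod_v (fun _ _ => 1) v (phi v))).
  by apply: eq_mean => phi; rewrite big1.
rewrite (mean_prod (fun _ _ => 1)) big1 // => v _.
by rewrite -[RHS]q_sum; apply: eq_bigr => k _; rewrite mulr1.
Qed.

Lemma updC phi x x' k k' : x != x' ->
  upd (upd phi x k) x' k' = upd (upd phi x' k') x k.
Proof.
move=> ne; apply/ffunP => v; rewrite !ffunE.
by case: (v =P x') => // ->; rewrite eq_sym (negbTE ne).
Qed.

Lemma upd_upd phi x k k' : upd (upd phi x k) x k' = upd phi x k'.
Proof. by apply/ffunP => v; rewrite !ffunE; case: eqP. Qed.

Lemma upd_id phi x : upd phi x (phi x) = phi.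
Proof. by apply/ffunP => v; rewrite !ffunE; case: eqP => // ->. Qed.

(** The map [(phi, k) |-> (upd phi x k, phi x)] is a weight-preserving
    involution, so redrawing one coordinate does not change the law. *)
Lemma mean_resample x F : mean (resample x F) = mean F.
Proof.
pose sw (a : {ffun I -> T} * T) := (upd a.1 x a.2, a.1 x).
have swK : cancel sw sw.
  by case=> phi k; rewrite /sw /= upd_upd upd_id ffunE eqxx.
pose W (a : {ffun I -> T} * T) := (\prod_v q (a.1 v)) * q a.2.
have W_sw a : W (sw a) = W a.
  case: a => phi k; rewrite /W /sw /= (bigD1 x) //= [in RHS](bigD1 x) //=.
  rewrite ffunE eqxx (eq_bigr (fun v => q (phi v))); first by ring.
  by move=> v /negbTE ne; rewrite ffunE ne.
transitivity (\sum_a W a * F (sw a).1).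
  rewrite -(pair_bigA _ (fun phi k => W (phi, k) * F (sw (phi, k)).1)) /=.
  apply: eq_bigr => phi _; rewrite mulr_sumr; apply: eq_bigr => k _.
  by rewrite /W /=; ring.
rewrite (reindex_inj (can_inj swK)).
rewrite (eq_bigr (fun a => W a * F a.1)); last by move=> a _; rewrite swK W_sw.
rewrite -(pair_bigA _ (fun phi k => W (phi, k) * F phi)) /=.
apply: eq_bigr => phi _.
rewrite -[RHS]mulr1 -[X in _ * X]q_sum mulr_sumr; apply: eq_bigr => k _.
by rewrite /W /=; ring.
Qed.

Lemma resample_ignores x F : ignores F x -> resample x F =1 F.
Proof.
move=> ign phi; rewrite /resample (eq_bigr (fun k => q k * F phi)).
  by rewrite -mulr_suml q_sum mul1r.
by move=> k _; rewrite ign.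
Qed.

Lemma ignores_resample x F : ignores (resample x F) x.
Proof. by move=> phi k; apply: eq_bigr => k' _; rewrite upd_upd. Qed.

Lemma ignores_resample_other x x' F : ignores F x -> ignores (resample x' F) x.
Proof.
move=> ign; have [->|ne] := eqVneq x x'; first exact: ignores_resample.
by move=> phi k; apply: eq_bigr => k' _; rewrite updC // ign.
Qed.

Lemma ignores_all_const F : (forall x, ignores F x) ->
  forall phi phi', F phi = F phi'.
Proof.
move=> ign phi phi'.
suff main (s : seq I) : F phi = F [ffun v => if v \in s then phi' v else phi v].
  rewrite (main (enum I)); congr F.
  by apply/ffunP => v; rewrite ffunE mem_enum.
elim: s => [|x s ->]; first by congr F; apply/ffunP => v; rewrite ffunE.
rewrite -(ign x _ (phi' x)); congr F; apply/ffunP => v; rewrite !ffunE inE.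
by case: eqP => // ->.
Qed.

Lemma mean_const F : (forall phi phi', F phi = F phi') ->
  forall phi, mean F = F phi.
Proof.
move=> F_const phi; rewrite -[RHS]mul1r -mean1 -meanZr.
by apply: eq_mean => phi'; rewrite mul1r.
Qed.

(** One coordinate at a time: all factors but one are constant under the redrawing
    of that coordinate, so the average falls on the remaining factor. *)
Lemma mean_resample_factors (P : pred I) (F : I -> {ffun I -> T} -> R) :
    (forall y y', P y -> P y' -> y != y' -> ignores (F y) y') ->
  mean (fun phi => \prod_(y | P y) F y phi)
    = mean (fun phi => \prod_(y | P y) resample y (F y) phi).
Proof.
move=> ign.
suff main (s : seq I) : uniq s -> all P s ->
    mean (fun phi => \prod_(y | P y) F y phi) =
    mean (fun phi => \prod_(y | P y)
                       (if y \in s then resample y (F y) phi else F y phi)).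
  rewrite (main (enum P)) ?enum_uniq //; last first.
    by apply/allP => y; rewrite mem_enum.
  apply: eq_mean => phi; apply: eq_bigr => y Py.
  by rewrite mem_enum unfold_in Py.
elim: s => [_ _|x s IHs /= /andP[xs us] /andP[Px Ps]].
  by apply: eq_mean => phi; apply: eq_bigr.
rewrite IHs // -[LHS](mean_resample x); apply: eq_mean => phi.
have ign' (y : I) : P y -> y != x -> ignores
    (fun phi => if y \in s then resample y (F y) phi else F y phi) x.
  move=> Py ne; case: (y \in s) => [|phi0 k]; last exact: ign.
  by apply: ignores_resample_other; exact: ign.
rewrite /resample [RHS](bigD1 x) //= inE eqxx /= mulr_suml.
apply: eq_bigr => k _; rewrite (bigD1 x) //= (negbTE xs) mulrA.
congr (_ * _); apply: eq_bigr => y /andP[Py ne].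
by rewrite inE (negbTE ne) /= ign'.
Qed.

End ProductMean.

(** * Inequalities of Hoelder and Finner *)

Section Holder.
Variable R : realType.

Lemma natr_root_exists (D : nat) (a : R) : (0 < D)%N -> 0 <= a ->
  (a `^ (D%:R^-1)) ^+ D = a.
Proof.
move=> D0 a0; rewrite -powR_mulrn ?powR_ge0 // -powRrM mulVf ?powRr1 //.
by rewrite pnatr_eq0 -lt0n.
Qed.

(** Arithmetic-geometric mean for the [D] numbers consisting of the [u i ^+ D]
    and of as many ones as needed to complete the list. *)
Lemma young_prod (J : finType) (A : {set J}) (D : nat) (u : J -> R) :
    (0 < D)%N -> (#|A| <= D)%N -> (forall i, 0 <= u i) ->
  \prod_(i in A) u i <= (\sum_(i in A) u i ^+ D + (D - #|A|)%:R) / D%:R.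
Proof.
move=> D0 AD u0.
have [e De] : exists e, (#|A| + e)%N = D by exists (D - #|A|)%N; rewrite subnKC.
have -> : (D - #|A|)%N = e by rewrite -De addKn.
pose E (s : J + 'I_e) : R := if s is inl i then u i ^+ D else 1.
pose B : {pred J + 'I_e} := [pred s | if s is inl i then i \in A else true].
have E0 s : s \in B -> 0 <= E s by case: s => [i|i] _ /=; rewrite ?exprn_ge0.
have cardB : #|B| = D.
  rewrite -sum1_card big_sumType /= sum1_card sum1_card -[RHS]De.
  by congr addn; rewrite -[RHS](card_ord e); apply: eq_card.
have := (leif_AGM E0).1; rewrite cardB.
have -> : \prod_(i in B) E i = (\prod_(i in A) u i) ^+ D.
  rewrite big_sumType /= -prodrXl [X in _ * X]big1 ?mulr1 //.
have -> : \sum_(i in B) E i = \sum_(i in A) u i ^+ D + e%:R.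
  by rewrite big_sumType /= sumr_const card_ord.
move=> le; rewrite -(@ler_pXn2r _ D) // nnegrE ?prodr_ge0 //.
rewrite divr_ge0 // addr_ge0 // sumr_ge0 // => i _; exact: exprn_ge0.
Qed.

(** Dividing each factor by its [D]-norm reduces the claim to the average of the
    pointwise inequality [young_prod]; a vanishing norm kills both sides. *)
Lemma holder_prod (T J : finType) (q : T -> R) (A : {set J}) (D : nat)
    (h : J -> T -> R) (r : J -> R) :
    (forall k, 0 <= q k) -> \sum_k q k = 1 ->
    (0 < D)%N -> (#|A| <= D)%N -> (forall i k, 0 <= h i k) ->
    (forall i, 0 <= r i) ->
    (forall i, i \in A -> r i ^+ D = \sum_k q k * h i k ^+ D) ->
  \sum_k q k * \prod_(i in A) h i k <= \prod_(i in A) r i.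
Proof.
move=> q0 q1 D0 AD h0 r0 rE.
have [/existsP[i /andP[iA /eqP ri]]|/existsPn r_neq0] :=
  boolP [exists i, (i \in A) && (r i == 0)].
  rewrite (bigD1 i) //= ri mul0r big1 // => k _.
  have /eqP : q k * h i k ^+ D = 0.
    have := rE i iA; rewrite ri expr0n gtn_eqF // => /esym/eqP.
    rewrite psumr_eq0 => [/allP/(_ k)|k' _]; last by rewrite mulr_ge0 ?exprn_ge0.
    by rewrite mem_index_enum => /(_ isT)/implyP/(_ isT)/eqP.
  rewrite mulf_eq0 expf_eq0 D0 /= => /orP[/eqP->|/eqP hik]; first exact: mul0r.
  by rewrite (bigD1 i) //= hik mul0r mulr0.
have r_gt0 i : i \in A -> 0 < r i.
  by move=> iA; rewrite lt0r r0 andbT; have := r_neq0 i; rewrite iA.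
have rA : 0 < \prod_(i in A) r i by exact: prodr_gt0.
rewrite -[leRHS]mul1r -ler_pdivrMr // mulr_suml.
have unit_norm i : i \in A -> \sum_k q k * (h i k / r i) ^+ D = 1.
  move=> iA; rewrite (eq_bigr (fun k => q k * h i k ^+ D / r i ^+ D)).
    by rewrite -mulr_suml -rE // divff // expf_neq0 // gt_eqF // r_gt0.
  by move=> k _; rewrite expr_div_n mulrA.
apply: (@le_trans _ _ (\sum_k q k *
    ((\sum_(i in A) (h i k / r i) ^+ D + (D - #|A|)%:R) / D%:R))).
  apply: ler_sum => k _; rewrite -mulrA; apply: ler_wpM2l => //.
  rewrite -prodf_div; apply: young_prod => // i.
  by rewrite divr_ge0.
under eq_bigr => k _ do rewrite mulrA mulrDr.
rewrite -mulr_suml big_split /= -mulr_suml q1 mul1r.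
under eq_bigr => k _ do rewrite mulr_sumr.
rewrite exchange_big (eq_bigr (fun=> 1)) //= sumr_const -natrD subnKC //.
by rewrite divff // pnatr_eq0 -lt0n.
Qed.

End Holder.

Section Finner.
Variables (R : realType) (I T J : finType) (q : T -> R).
Hypotheses (q_ge0 : forall k, 0 <= q k) (q_sum : \sum_k q k = 1).
Variables (A : {set J}) (D : nat) (S : J -> I -> bool).
Hypotheses (D_gt0 : (0 < D)%N)
  (S_deg : forall x, (#|[set y in A | S y x]| <= D)%N).

Local Notation mean := (@mean R I T q).

Definition coord_norm (x : I) (F : {ffun I -> T} -> R) phi :=
  (resample q x (fun psi => F psi ^+ D) phi) `^ D%:R^-1.

(** Conditionally on the other coordinates, this is [holder_prod] for the at most
    [D] factors that see [x]; the others are their own [coord_norm]. *)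
Lemma finner_step (x : I) (F : J -> {ffun I -> T} -> R) :
    (forall y phi, 0 <= F y phi) ->
    (forall y, ~~ S y x -> ignores (F y) x) ->
  mean (fun phi => \prod_(y in A) F y phi)
    <= mean (fun phi => \prod_(y in A) coord_norm x (F y) phi).
Proof.
move=> F0 ign; rewrite -[leLHS](mean_resample q_sum x).
apply: le_mean => // phi.
have E0 y : 0 <= resample q x (fun psi => F y psi ^+ D) phi.
  by apply: sumr_ge0 => k _; rewrite mulr_ge0 // exprn_ge0.
rewrite (bigID (fun y => S y x)) /= /resample.
have -> : \sum_k q k * \prod_(y in A) F y (upd phi x k) =
    (\sum_k q k * \prod_(y in [set y in A | S y x]) F y (upd phi x k))
    * \prod_(y in A | ~~ S y x) coord_norm x (F y) phi.
  rewrite mulr_suml; apply: eq_bigr => k _.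
  rewrite (bigID (fun y => S y x)) /= mulrA; congr (_ * _ * _).
    by apply: eq_bigl => y; rewrite inE.
  apply: eq_bigr => y /andP[_ nS]; rewrite ign // /coord_norm.
  rewrite resample_ignores //; last by move=> psi k'; rewrite ign.
  apply: (@pexpIrn _ D) => //; rewrite ?nnegrE ?powR_ge0 //.
  by rewrite natr_root_exists // exprn_ge0.
apply: ler_wpM2r; first by apply: prodr_ge0 => y _; exact: powR_ge0.
rewrite [leRHS](eq_bigl (fun y => y \in [set y in A | S y x])); last first.
  by move=> y; rewrite inE.
apply: (holder_prod q_ge0 q_sum D_gt0 (S_deg x)) => [y k|y|y _] //.
  exact: powR_ge0.
by rewrite natr_root_exists.
Qed.

(** Finner's inequality.  Treating the coordinates one by one with [finner_step]
    makes each factor a constant, namely its [D]-norm, because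
    [coord_norm] preserves the mean of the [D]-th power. *)
Lemma finner (F : J -> {ffun I -> T} -> R) :
    (forall y phi, 0 <= F y phi) ->
    (forall y x, ~~ S y x -> ignores (F y) x) ->
  mean (fun phi => \prod_(y in A) F y phi) ^+ D
    <= \prod_(y in A) mean (fun phi => F y phi ^+ D).
Proof.
move=> F0 F_ign.
suff main (s : seq I) : exists F' : J -> {ffun I -> T} -> R,
    [/\ forall y phi, 0 <= F' y phi,
        forall y, mean (fun phi => F' y phi ^+ D) = mean (fun phi => F y phi ^+ D),
        forall y x, ~~ S y x || (x \in s) -> ignores (F' y) x &
        mean (fun phi => \prod_(y in A) F y phi)
          <= mean (fun phi => \prod_(y in A) F' y phi)].
  have [F' [F'0 F'E F'_ign le]] := main (enum I).
  have F'const y : forall phi phi', F' y phi = F' y phi'.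
    by apply: ignores_all_const => x; apply: F'_ign; rewrite mem_enum orbT.
  have [k0 _] : exists k : T, q k != 0.
    apply/existsP; rewrite -[X in is_true X]negbK negb_exists.
    apply/negP => /forallP q0.
    move: q_sum; rewrite big1 => [/eqP|k _]; first by rewrite eq_sym oner_eq0.
    by have := q0 k; rewrite negbK => /eqP.
  pose phi0 : {ffun I -> T} := [ffun=> k0].
  apply: (@le_trans _ _ (mean (fun phi => \prod_(y in A) F' y phi) ^+ D)).
    have mean_ge0 (E : {ffun I -> T} -> R) : (forall phi, 0 <= E phi) -> 0 <= mean E.
      by move=> E0; apply: sumr_ge0 => phi _; rewrite mulr_ge0 ?prod_q_ge0.
    apply: lerXn2r => //; rewrite nnegrE; apply: mean_ge0 => phi;
      exact: prodr_ge0.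
  rewrite (@mean_const _ _ _ _ q_sum _ _ phi0) => [|phi phi']; last first.
    by apply: eq_bigr => y _; exact: F'const.
  rewrite -prodrXl; apply: ler_prod => y _.
  rewrite exprn_ge0 //= -F'E (@mean_const _ _ _ _ q_sum _ _ phi0) //.
  by move=> phi phi'; rewrite (F'const y phi phi').
elim: s => [|x s [F' [F'0 F'E F'_ign le]]].
  by exists F; split=> // y x; rewrite in_nil orbF => /F_ign.
pose F2 y := coord_norm x (F' y).
have F2X y phi : F2 y phi ^+ D = resample q x (fun psi => F' y psi ^+ D) phi.
  rewrite natr_root_exists // sumr_ge0 // => k _.
  by rewrite mulr_ge0 // exprn_ge0.
exists F2; split=> [y phi|y|y x'|]; first exact: powR_ge0.
- rewrite -F'E -[RHS](mean_resample q_sum x).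
  by apply: eq_mean => phi; exact: F2X.
- rewrite inE => Sx phi k; congr (_ `^ _).
  case/orP: Sx => [Sx|/orP[/eqP->|Sx]].
  + apply: ignores_resample_other => psi k'.
    by rewrite (F'_ign y x') // Sx.
  + exact: ignores_resample.
  + apply: ignores_resample_other => psi k'.
    by rewrite (F'_ign y x') // Sx orbT.
- apply: (le_trans le); apply: finner_step => // y Sx.
  by apply: F'_ign; rewrite Sx.
Qed.

End Finner.

(** * Weights of colour sets and degrees *)

Section SetWeight.
Variables (R : realType) (H : graph) (lam : H -> R).
Hypothesis lam_gt0 : forall i, 0 < lam i.

Definition common_nbrs (A : {set H}) : {set H} :=
  [set k | [forall x in A, adj x k]].

Lemma joined_common_nbrs (A : {set H}) : joined A (common_nbrs A).
Proof.
apply/forall_inP => u uA; apply/forall_inP => v; rewrite inE => /forall_inP.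
by apply.
Qed.

Lemma set_weight_ge0 (A : {set H}) : 0 <= set_weight lam A.
Proof. by apply: sumr_ge0 => i _; exact: ltW. Qed.

Lemma set_weight_indic (P : pred H) :
  \sum_i lam i * (P i)%:R = set_weight lam [set i | P i].
Proof.
rewrite /set_weight [RHS]big_mkcond; apply: eq_bigr => i _; rewrite inE.
by case: (P i); rewrite ?mulr1 ?mulr0.
Qed.

Lemma set_weight_sub (A B : {set H}) :
  A \subset B -> set_weight lam A <= set_weight lam B.
Proof.
move=> AB; rewrite /set_weight [leRHS](big_setID A) /= (finset.setIidPr AB) lerDl.
by apply: sumr_ge0 => i _; exact: ltW.
Qed.

Lemma le_set_weight (A : {set H}) i : i \in A -> lam i <= set_weight lam A.
Proof.
by move=> iA; rewrite -[lam i](big_set1 +%R) set_weight_sub // finset.sub1set.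
Qed.

Lemma total_weightE : total_weight lam = \sum_i lam i.
Proof. by apply: eq_bigl => i; rewrite inE. Qed.

Lemma total_weight_gt0 : has_edge H -> 0 < total_weight lam.
Proof.
by case=> i _; apply: (lt_le_trans (lam_gt0 i)); rewrite le_set_weight.
Qed.

End SetWeight.

Definition degree (G : graph) (v : G) : nat := #|[set u | adj v u]|.

Section DoubleCounting.
Variable G : graph.

Definition proper (c : G -> bool) := forall u v : G, adj u v -> c u != c v.

Definition balanced (c : G -> bool) :=
  #|[set v | c v]| = #|[set v | ~~ c v]|.

Lemma sum_card_swap (P Q : pred G) (r : rel G) :
  (\sum_(y | P y) #|[set x in [set x | Q x] | r y x]|
   = \sum_(x | Q x) #|[set y in [set y | P y] | r y x]|)%N.
Proof.
transitivity (\sum_(y | P y) \sum_(x | Q x) r y x)%N.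
  apply: eq_bigr => y _; rewrite -sum1_card [RHS]big_mkcond [LHS]big_mkcond.
  by apply: eq_bigr => x _; rewrite !inE; case: (Q x); case: (r y x).
rewrite exchange_big; apply: eq_bigr => x _.
rewrite -sum1_card [RHS]big_mkcond [LHS]big_mkcond.
by apply: eq_bigr => y _; rewrite !inE; case: (P y); case: (r y x).
Qed.

Lemma sum_degree_classes (c : G -> bool) : proper c ->
  (\sum_(y | ~~ c y) degree y = \sum_(x | c x) degree x)%N.
Proof.
move=> c_proper.
transitivity (\sum_(y | ~~ c y) #|[set x in [set x | c x] | adj y x]|)%N.
  apply: eq_bigr => y cy; apply: eq_card => x; rewrite !inE andbC.
  by case yx: (adj y x) => //; move: (c_proper _ _ yx) cy; case: (c x); case: (c y).
rewrite sum_card_swap; apply: eq_bigr => x cx; apply: eq_card => y.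
rewrite !inE adj_sym andbC.
by case xy: (adj x y) => //; move: (c_proper _ _ xy) cx; case: (c x); case: (c y).
Qed.

Lemma balanced_card (c : G -> bool) : balanced c ->
  #|G| = (#|[set v | c v]| + #|[set v | c v]|)%N.
Proof.
move=> bal; rewrite {2}bal -cardsT -(cardsID [set v | c v] finset.setT).
rewrite finset.setTI; congr addn.
by apply: eq_card => v; rewrite !inE andbT.
Qed.

(** Both classes meet all the edges, [n] times their size in number. *)
Lemma regular_balanced (c : G -> bool) (n : nat) :
  proper c -> (0 < n)%N -> regular n G -> balanced c.
Proof.
move=> c_proper n_gt0 G_reg; apply/eqP; rewrite -(eqn_pmul2r n_gt0) eq_sym.
apply/eqP; have := sum_degree_classes c_proper.
rewrite !(eq_bigr (fun=> n) (fun v _ => G_reg v)) !sum_nat_const => e.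
by apply: etrans (etrans _ e) _; congr (_ * _)%N; apply: eq_card => v; rewrite !inE.
Qed.

End DoubleCounting.

Lemma natr_forall (R : realType) (I : finType) (P : pred I) :
  ([forall x, P x]%:R : R) = \prod_x (P x)%:R.
Proof.
have [/forallP Pall|/forallPn[x Px]] := boolP [forall x, P x].
  by rewrite big1 // => x _; rewrite Pall.
by rewrite (bigD1 x) //= (negbTE Px) mul0r.
Qed.

(** * Partition functions of nearly regular bipartite graphs *)

Section BipartiteBound.
Variables (R : realType) (G H : graph) (lam : H -> R).
Hypotheses (lam_gt0 : forall i, 0 < lam i) (H_edge : has_edge H).
Variables (c : G -> bool) (D : nat) (K L : R).
Hypotheses (c_proper : proper c) (D_gt0 : (0 < D)%N).
Hypothesis joined_le :
  forall A B : {set H}, joined A B -> set_weight lam A * set_weight lam B <= K.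

Let W := total_weight lam.
Let q i := lam i / W.
Let kappa := K / W ^+ 2.

Hypotheses (L_ge0 : 0 <= L) (L_lam : forall i, expR (- L) <= q i)
  (L_K : expR (- L) <= kappa).

Let W_gt0 : 0 < W. Proof. exact: total_weight_gt0. Qed.
Let q_gt0 i : 0 < q i. Proof. exact: divr_gt0. Qed.
Let q_ge0 i : 0 <= q i. Proof. exact: ltW. Qed.
Let q_sum : \sum_i q i = 1.
Proof. by rewrite -mulr_suml -total_weightE // divff // gt_eqF. Qed.
Let set_weight_q A : set_weight q A = set_weight lam A / W.
Proof. by rewrite /set_weight mulr_suml. Qed.
Let set_weight_q_le1 A : set_weight q A <= 1.
Proof. by rewrite -q_sum -total_weightE; apply: set_weight_sub; rewrite ?finset.subsetT. Qed.
Let kappa_ge0 : 0 <= kappa. Proof. exact: (le_trans (expR_ge0 _) L_K). Qed.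

(** The exponent [d] falls short of [D] at a cost of [expR L] per missing unit;
    this is where an edge or a nonempty [T] keeps the weights away from zero. *)
Let power_bound (T : {set H}) (d : nat) :
  set_weight q T ^+ d * set_weight q (common_nbrs T) ^+ D
    <= kappa ^+ D * expR L ^+ (D - d).
Proof.
set t := set_weight q T; set b := set_weight q (common_nbrs T).
have t0 : 0 <= t by exact: set_weight_ge0.
have b0 : 0 <= b by exact: set_weight_ge0.
have t1 : t <= 1 by exact: set_weight_q_le1.
have b1 : b <= 1 by exact: set_weight_q_le1.
have tb : t * b <= kappa.
  rewrite /t /b !set_weight_q mulrACA -expr2 exprVn ler_wpM2r //.
    by rewrite invr_ge0 exprn_ge0 // ltW.
  by apply: joined_le; exact: joined_common_nbrs.
have tbD : t ^+ D * b ^+ D <= kappa ^+ D.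
  by rewrite -exprMn; apply: lerXn2r => //; rewrite nnegrE mulr_ge0.
have [Dd|dD] := leqP D d.
  have /eqP -> : (D - d == 0)%N by rewrite subn_eq0.
  rewrite expr0 mulr1; apply: le_trans tbD; apply: ler_wpM2r; rewrite ?exprn_ge0 //.
  by rewrite -(subnK Dd) exprD ler_piMl ?exprn_ge0 // exprn_ile1.
have [T0|[i iT]] := finset.set_0Vmem T.
  have -> : t = 0 by rewrite /t /set_weight T0 big_set0.
  case: d dD => [|d] dD; last first.
    by rewrite expr0n mul0r mulr_ge0 // exprn_ge0 // expR_ge0.
  rewrite expr0 mul1r subn0 -exprMn.
  apply: (@le_trans _ _ 1); first exact: exprn_ile1.
  apply: exprn_ege1.
  by rewrite -(mulVf (lt0r_neq0 (expR_gt0 L))) -expRN; apply: ler_wpM2r; rewrite ?expR_ge0.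
have tL : 1 <= t * expR L.
  rewrite -(mulVf (lt0r_neq0 (expR_gt0 L))) -expRN; apply: ler_wpM2r; rewrite ?expR_ge0 //.
  by apply: (le_trans (L_lam i)); exact: le_set_weight.
apply: (@le_trans _ _ ((t * expR L) ^+ (D - d) * (t ^+ d * b ^+ D))).
  by apply: ler_peMl; rewrite ?mulr_ge0 ?exprn_ge0 // exprn_ege1.
rewrite exprMn mulrACA -exprD subnK; last exact: ltnW.
rewrite mulrCA mulrC; apply: ler_wpM2r; rewrite ?exprn_ge0 ?expR_ge0 //.
Qed.

Section Selection.
(** Only the edges in [S] are enforced, which can only increase the partition
    function; this is how a vertex [x] is prevented from entering more than [D]
    constraints, as the exponent [D] in Finner's inequality requires. *)
Variable S : rel G.
Hypotheses (S_adj : forall y x, S y x -> adj y x)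
  (S_deg : forall x, (#|[set y in [set y | ~~ c y] | S y x]| <= D)%N).

Let nS y := #|[set x | S y x]|.

Let compat (y : G) (phi : {ffun G -> H}) : R :=
  [forall x, S y x ==> adj (phi x) (phi y)]%:R.

Let avail (y : G) (phi : {ffun G -> H}) : R :=
  \sum_k q k * [forall x, S y x ==> adj (phi x) k]%:R.

Let S_upd y x phi k : S y x -> ~~ c y -> @upd G H phi y k x = phi x.
Proof.
move=> /S_adj/c_proper ne cy; rewrite ffunE.
by case: eqP => // xy; rewrite xy eqxx in ne.
Qed.

(** The colour of [y] occurs in the constraint of [y] alone and is averaged out. *)
Let mean_compat :
  mean q (fun phi : {ffun G -> H} => \prod_(y | ~~ c y) compat y phi)
  = mean q (fun phi => \prod_(y in [set y | ~~ c y]) avail y phi).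
Proof.
rewrite (mean_resample_factors q_sum) => [|y y' cy cy' ne phi k].
  apply: eq_mean => phi; apply: eq_big => [y|y cy]; first by rewrite inE.
  apply: eq_bigr => k _; congr (_ * _%:R); congr nat_of_bool.
  apply: eq_forallb => x; case Sx: (S y x) => //=.
  by rewrite S_upd // ffunE eqxx.
congr (nat_of_bool _)%:R; apply: eq_forallb => x; case Sx: (S y x) => //=.
rewrite !ffunE (negbTE ne); case: eqP => // xy'.
have := c_proper (S_adj Sx); rewrite xy'.
by move: cy cy'; case: (c y); case: (c y').
Qed.

Let mean_indic y (T : {set H}) :
  mean q (fun phi : {ffun G -> H} => [forall x, S y x ==> (phi x \in T)]%:R)
  = set_weight q T ^+ nS y.
Proof.
rewrite (@eq_mean _ _ _ _ _ (fun phi : {ffun G -> H} =>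
  \prod_x (fun v k => (S y v ==> (k \in T))%:R) x (phi x))); last first.
  by move=> phi; rewrite natr_forall.
rewrite (mean_prod q (fun v k => (S y v ==> (k \in T))%:R)) (bigID (S y)) /=.
rewrite [X in _ * X]big1 ?mulr1 => [|x /negbTE ->]; last first.
  by rewrite -[RHS]q_sum; apply: eq_bigr => k _; rewrite mulr1.
rewrite /nS -prodr_const; apply: eq_big => [x|x Sx]; first by rewrite inE.
rewrite Sx set_weight_indic; apply: eq_bigl => k; by rewrite inE.
Qed.

(** If [T] is the set of colours seen by [y], then [y] has [common_nbrs T] to choose
    from; a union bound over [T] reduces the claim to [power_bound]. *)
Let mean_avail y :
  mean q (fun phi => avail y phi ^+ D)
  <= 2 ^+ #|H| * kappa ^+ D * expR L ^+ (D - nS y).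
Proof.
apply: (@le_trans _ _ (mean q (fun phi : {ffun G -> H} =>
   \sum_(T : {set H}) [forall x, S y x ==> (phi x \in T)]%:R
     * set_weight q (common_nbrs T) ^+ D))).
  apply: le_mean => // phi.
  pose T0 := [set phi x | x in [set x | S y x]].
  have T0E : avail y phi = set_weight q (common_nbrs T0).
    rewrite /avail set_weight_indic; apply: eq_bigl => k; rewrite !inE.
    apply/forallP/forall_inP => [Sk i /imsetP[x]|Tk x].
      by rewrite inE => Sx ->; exact: (implyP (Sk x)).
    by apply/implyP => Sx; apply: Tk; rewrite imset_f // inE.
  rewrite (bigD1 T0) //= T0E.
  have -> : [forall x, S y x ==> (phi x \in T0)].
    by apply/forallP => x; apply/implyP => Sx; rewrite imset_f // inE.
  rewrite mul1r lerDl sumr_ge0 // => T _.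
  by rewrite mulr_ge0 // exprn_ge0 // set_weight_ge0.
rewrite mean_sum; under eq_bigr => T _ do rewrite meanZr mean_indic.
apply: (@le_trans _ _ (\sum_(T : {set H}) (kappa ^+ D * expR L ^+ (D - nS y)))).
  by apply: ler_sum => T _; exact: power_bound.
rewrite sumr_const -[leLHS]mulr_natl -mulrA; apply: ler_wpM2r.
  by rewrite mulr_ge0 // exprn_ge0 // expR_ge0.
rewrite -natrX -[#|H|]cardsT -card_powerset ler_nat.
by apply: subset_leq_card; apply/fintype.subsetP => T _; rewrite !inE finset.subsetT.
Qed.

Lemma Zpart_selection_le :
  Zpart G lam ^+ D <= W ^+ (#|G| * D) *
    \prod_(y | ~~ c y) (2 ^+ #|H| * kappa ^+ D * expR L ^+ (D - nS y)).
Proof.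
have Z_le : Zpart G lam <= W ^+ #|G| *
    mean q (fun phi => \prod_(y in [set y | ~~ c y]) avail y phi).
  rewrite -mean_compat mulr_sumr /Zpart big_mkcond /=; apply: ler_sum => phi _.
  rewrite mulrA; have -> : W ^+ #|G| * \prod_v q (phi v) = col_weight lam phi.
    rewrite -prodr_const -big_split; apply: eq_bigr => v _ /=.
    by rewrite mulrC divfK // gt_eqF.
  have cw0 : 0 <= col_weight lam phi by apply: prodr_ge0 => v _; exact: ltW.
  case: ifP => [|_]; last first.
    by rewrite mulr_ge0 // prodr_ge0 // => y _; rewrite /compat.
  rewrite inE => /forallP hom; rewrite big1 ?mulr1 // => y _.
  rewrite /compat; have -> // : [forall x, S y x ==> adj (phi x) (phi y)].
  apply/forallP => x; apply/implyP => /S_adj; rewrite adj_sym.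
  exact: (implyP (forallP (hom x) y)).
have Z0 : 0 <= Zpart G lam.
  by apply: sumr_ge0 => phi _; apply: prodr_ge0 => v _; exact: ltW.
apply: le_trans (lerXn2r D _ _ Z_le) _; rewrite ?nnegrE //.
  exact: le_trans Z0 Z_le.
rewrite exprMn -exprM; apply: ler_wpM2l; first by rewrite exprn_ge0 // ltW.
have avail_ge0 y phi : 0 <= avail y phi.
  by apply: sumr_ge0 => k _; rewrite mulr_ge0.
apply: le_trans (finner q_ge0 q_sum D_gt0 S_deg avail_ge0 _) _.
  move=> y x nSx phi k; apply: eq_bigr => k' _; congr (_ * _%:R).
  congr nat_of_bool; apply: eq_forallb => x'; case Sx': (S y x') => //=.
  by rewrite ffunE; case: eqP => // xx; rewrite -xx Sx' in nSx.
rewrite [leRHS](eq_bigl (fun y => y \in [set y | ~~ c y])); last first.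
  by move=> y; rewrite inE.
apply: ler_prod => y _; rewrite mean_avail andbT.
apply: sumr_ge0 => phi _; rewrite mulr_ge0 ?exprn_ge0 //.
exact: prod_q_ge0.
Qed.

End Selection.

Let trunc (y x : G) := c x && (y \in take D (enum [set u | adj x u])).

Let trunc_adj y x : trunc y x -> adj y x.
Proof.
by case/andP => _ /mem_take; rewrite mem_enum inE adj_sym.
Qed.

Let card_trunc x : c x ->
  #|[set y in [set y | ~~ c y] | trunc y x]| = minn D (degree x).
Proof.
move=> cx; rewrite /degree [in RHS]cardE -size_take_min.
rewrite -(card_uniqP (take_uniq D (enum_uniq _))); apply: eq_card => y.
rewrite !inE /trunc cx /=; case yE: (_ \in take _ _); rewrite ?andbF ?andbT //.
move: yE => /mem_take; rewrite mem_enum inE => /c_proper; rewrite cx.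
by case: (c y).
Qed.

Let trunc_deg x : (#|[set y in [set y | ~~ c y] | trunc y x]| <= D)%N.
Proof.
have [cx|ncx] := boolP (c x); first by rewrite card_trunc // geq_minl.
rewrite (_ : [set _ in _ | _] = finset.set0) ?cards0 //; apply/setP => y.
by rewrite !inE /trunc (negbTE ncx) andbF.
Qed.

(** Both classes have the same total degree, so the edges lost by truncation are
    charged to the vertices of degree above [D] in the class [c], and the other
    deficits to the vertices outside [c]. *)
Let trunc_deficit :
  (\sum_(y | ~~ c y) (D - #|[set x | trunc y x]|))%N%:R
    <= \sum_(v : G) `|(degree v)%:R - D%:R| :> R.
Proof.
have e1 := sum_degree_classes c_proper.
have e2 : (\sum_(y | ~~ c y) #|[set x | trunc y x]|
           = \sum_(x | c x) minn D (degree x))%N.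
  transitivity (\sum_(y | ~~ c y) #|[set x in [set x | c x] | trunc y x]|)%N.
    apply: eq_bigr => y cy; apply: eq_card => x; rewrite !inE /trunc.
    by case: (c x).
  by rewrite sum_card_swap; apply: eq_bigr => x cx; rewrite card_trunc.
have le1 y : ((D - #|[set x | trunc y x]|)%N%:R : R) <=
    `|(degree y)%:R - D%:R| + ((degree y)%:R - #|[set x | trunc y x]|%:R).
  have sub : (#|[set x | trunc y x]| <= degree y)%N.
    by apply: subset_leq_card; apply/fintype.subsetP => x; rewrite !inE; exact: trunc_adj.
  have sub' : (#|[set x | trunc y x]|%:R : R) <= (degree y)%:R by rewrite ler_nat.
  have [le|lt] := leqP #|[set x | trunc y x]| D.
    rewrite natrB //; have := ler_norm (- ((degree y)%:R - D%:R) : R).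
    by rewrite normrN; lra.
  have /eqP -> : (D - #|[set x | trunc y x]| == 0)%N by rewrite subn_eq0 ltnW.
  by rewrite addr_ge0 // subr_ge0.
rewrite natr_sum [leRHS](bigID c) /= [leRHS]addrC.
apply: le_trans (ler_sum _ (fun y _ => le1 y)) _.
rewrite big_split lerD2l /= sumrB -!natr_sum e1 e2 !natr_sum -sumrB.
apply: ler_sum => x _; rewrite -[leRHS]/(`|_ - _|).
have [le|lt] := leqP (degree x) D; first by rewrite subrr.
exact: ler_norm.
Qed.

(** For a [D]-regular graph the sum vanishes, and the bound is
    [K ^ (#|G| / 2)] up to the factor [expR (#|H| / D)] per vertex of a class. *)
Lemma bipartite_Zpart_le (m : nat) : balanced c -> #|[set v | c v]| = m ->
  Zpart G lam ^+ D <=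
    expR (#|H|%:R * m%:R + L * \sum_(v : G) `|(degree v)%:R - D%:R|)
    * K ^+ (m * D).
Proof.
move=> bal mc; apply: le_trans (Zpart_selection_le trunc_adj trunc_deg) _.
have GE : #|G| = (m + m)%N by rewrite -mc; exact: balanced_card.
have mnc : #|[set v | ~~ c v]| = m by rewrite -bal.
have prodE (a : R) : \prod_(y | ~~ c y) a = a ^+ m.
  rewrite -mnc -prodr_const; by apply: eq_bigl => v; rewrite inE.
rewrite !big_split /= !prodE prodrXr -!exprM.
have -> : W ^+ (#|G| * D) * (2 ^+ (#|H| * m) * kappa ^+ (D * m)
    * expR L ^+ (\sum_(y | ~~ c y) (D - #|[set x | trunc y x]|)))
  = (2 ^+ (#|H| * m) * expR L ^+ (\sum_(y | ~~ c y) (D - #|[set x | trunc y x]|)))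
    * K ^+ (m * D).
  have KE : K = W ^+ 2 * kappa by rewrite mulrC divfK // expf_neq0 // gt_eqF.
  have -> : K ^+ (m * D) = W ^+ (2 * (m * D)) * kappa ^+ (D * m).
    by rewrite {1}KE exprMn -exprM (mulnC D m).
  rewrite GE (_ : (2 * (m * D) = (m + m) * D)%N); last by rewrite mul2n -addnn mulnDl.
  by rewrite mulrA [in RHS]mulrC -!mulrA; congr (_ * _); rewrite mulrCA.
apply: ler_wpM2r.
  have [i [j ij]] := H_edge.
  apply: exprn_ge0; apply: le_trans (joined_le (joined_common_nbrs finset.set0)).
  by rewrite mulr_ge0 // set_weight_ge0.
rewrite expRD; apply: ler_pM; rewrite ?exprn_ge0 ?expR_ge0 //.
  have -> : #|H|%:R * m%:R = (#|H| * m)%:R * 1 :> R by rewrite natrM mulr1.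
  rewrite expRM_natl; apply: lerXn2r; rewrite ?nnegrE ?expR_ge0 //.
  by apply: le_trans (expR_ge1Dx _).
rewrite -expRM_natl ler_expR mulrC; exact: ler_wpM2l.
Qed.

End BipartiteBound.

(** * Tilted activities and concentration of colour shares *)

Section Colouring.
Variables (R : realType) (G H : graph) (lam : H -> R).
Hypothesis lam_gt0 : forall i, 0 < lam i.

Let N : R := #|G|%:R.

(** All assignments that pick the colour of [v] from [S v] are homomorphisms. *)
Lemma Zpart_ge (S : G -> {set H}) :
    (forall u v, adj u v -> joined (S u) (S v)) ->
  \prod_v set_weight lam (S v) <= Zpart G lam.
Proof.
move=> S_joined.
have -> : \prod_v set_weight lam (S v)
    = mean lam (fun phi : {ffun G -> H} => \prod_v (fun v k => (k \in S v)%:R) v (phi v)).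
  rewrite (mean_prod lam (fun v k => (k \in S v)%:R)); apply: eq_bigr => v _.
  by rewrite set_weight_indic; apply: eq_bigl => k; rewrite inE.
rewrite /Zpart [leRHS]big_mkcond; apply: ler_sum => phi _ /=.
rewrite -natr_forall -/(col_weight lam phi).
have cw0 : 0 <= col_weight lam phi by apply: prodr_ge0 => v _; exact: ltW.
have [/forallP phiS|_] := boolP [forall v, phi v \in S v]; last first.
  by rewrite mulr0; case: ifP.
rewrite mulr1 inE; case: ifP => // /negP[]; apply/forallP => u; apply/forallP => v.
apply/implyP => /S_joined /forall_inP/(_ _ (phiS u))/forall_inP; exact.
Qed.

Lemma Zpart_le_total : Zpart G lam <= total_weight lam ^+ #|G|.
Proof.
rewrite /Zpart [leLHS]big_mkcond.
have -> : total_weight lam ^+ #|G| = \sum_(phi : {ffun G -> H}) col_weight lam phi.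
  transitivity (\prod_(v : G) \sum_i lam i); last by rewrite bigA_distr_bigA.
  by rewrite prodr_const total_weightE.
apply: ler_sum => phi _; case: ifP => // _.
by apply: prodr_ge0 => v _; exact: ltW.
Qed.

Lemma col_share_ge0 k (phi : {ffun G -> H}) : 0 <= col_share R k phi.
Proof. exact: divr_ge0. Qed.

Lemma col_share_le1 k (phi : {ffun G -> H}) : col_share R k phi <= 1.
Proof.
have [G0|G0] := posnP #|G|; first by rewrite /col_share G0 invr0 mulr0.
by rewrite ler_pdivrMr ?ltr0n // mul1r ler_nat max_card.
Qed.

(** With these activities the partition function is the generating function of the
    size of the colour class [k], see [col_weight_tilt]. *)
Definition tilt (k : H) (s : R) (i : H) : R := if i == k then lam i * (1 + s) else lam i.

Lemma tilt_gt0 k s : -1 < s -> forall i, 0 < tilt k s i.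
Proof. by move=> s1 i; rewrite /tilt; case: eqP => // _; rewrite mulr_gt0 //; lra. Qed.

Lemma set_weight_tilt k s (A : {set H}) :
  set_weight (tilt k s) A = set_weight lam A + s * (lam k * (k \in A)%:R).
Proof.
rewrite /set_weight /tilt; have [kA|kA] := boolP (k \in A).
  rewrite (bigD1 k) // eqxx /= [in RHS](bigD1 k) //=.
  rewrite (eq_bigr lam) => [|i /andP[_ /negbTE ->] //]; ring.
rewrite !mulr0 addr0; apply: eq_bigr => i iA; case: eqP => // ik.
by rewrite -ik iA in kA.
Qed.

Lemma col_weight_tilt k s (phi : {ffun G -> H}) :
  col_weight (tilt k s) phi
  = col_weight lam phi * (1 + s) ^+ #|[set v | phi v == k]|.
Proof.
rewrite /col_weight /tilt -prodr_const [X in _ * X]big_mkcond -big_split /=.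
by apply: eq_bigr => v _; rewrite inE; case: eqP; rewrite ?mulr1.
Qed.

Lemma expR_le_1Ds (s : R) : - 2^-1 <= s -> expR (s - 2 * s ^+ 2) <= 1 + s.
Proof.
move=> s_ge; have s1 : 0 < 1 + s by lra.
rewrite -[leRHS]invrK -[leLHS]invrK lef_pV2 ?posrE ?invr_gt0 ?expR_gt0 //.
rewrite -expRN.
apply: le_trans (expR_ge1Dx _).
rewrite -[(1 + s)^-1]mul1r ler_pdivrMr //.
have -> : (1 + - (s - 2 * s ^+ 2)) * (1 + s) = 1 + s ^+ 2 * (1 + 2 * s) by ring.
by rewrite lerDl mulr_ge0 ?sqr_ge0 //; lra.
Qed.

Hypothesis Z_gt0 : 0 < Zpart G lam.

Lemma p_mass_ge0 (phi : {ffun G -> H}) : 0 <= p_mass lam phi.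
Proof.
by rewrite divr_ge0 ?(ltW Z_gt0) //; apply: prodr_ge0 => v _; exact: ltW.
Qed.

Lemma sum_p_mass : \sum_(phi in Defs.Hom G H) p_mass lam phi = 1.
Proof. by rewrite -mulr_suml divff // gt_eqF. Qed.

Lemma p_probE (E : pred {ffun G -> H}) :
  p_prob lam E = \sum_(phi in Defs.Hom G H) p_mass lam phi * (E phi)%:R.
Proof.
rewrite /p_prob big_mkcondr; apply: eq_bigr => phi _.
by case: (E phi); rewrite ?mulr1 ?mulr0.
Qed.

Lemma p_barE k :
  p_bar G lam k = \sum_(phi in Defs.Hom G H) p_mass lam phi * col_share R k phi.
Proof.
rewrite /p_bar (eq_bigr (fun v =>
  \sum_(phi in Defs.Hom G H) p_mass lam phi * (phi v == k)%:R)); last first.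
  by move=> v _; rewrite p_probE.
rewrite exchange_big mulr_sumr; apply: eq_bigr => phi _.
rewrite -mulr_sumr mulrCA; congr (_ * _).
rewrite /col_share mulrC -natr_sum -sum1_card [in RHS]big_mkcond; congr (_%:R / _).
by apply: eq_bigr => v _; rewrite inE; case: (_ == _).
Qed.

Lemma le_p_expect (F F' : {ffun G -> H} -> R) : (forall phi, F phi <= F' phi) ->
  \sum_(phi in Defs.Hom G H) p_mass lam phi * F phi
  <= \sum_(phi in Defs.Hom G H) p_mass lam phi * F' phi.
Proof. by move=> le; apply: ler_sum => phi _; rewrite ler_wpM2l ?p_mass_ge0. Qed.

Lemma p_expect_affine (a : R) (F : {ffun G -> H} -> R) :
  \sum_(phi in Defs.Hom G H) p_mass lam phi * (a + F phi)
  = a + \sum_(phi in Defs.Hom G H) p_mass lam phi * F phi.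
Proof.
under eq_bigr => phi _ do rewrite mulrDr.
by rewrite big_split -mulr_suml sum_p_mass mul1r.
Qed.

(** Markov's inequality for [(1 + s) ^+ #|[set v | phi v == k]|], where
    [s = sg * r] and the sign [sg] selects the upper or the lower tail. *)
Lemma tilt_tail k (sg r a eps theta : R) :
    sg ^+ 2 = 1 -> 0 < r <= 2^-1 ->
    Zpart G (tilt k (sg * r)) <= Zpart G lam * expR (N * theta) ->
  p_prob lam (fun phi : {ffun G -> H} => sg * a + eps <= sg * col_share R k phi)
    <= expR (N * (theta - r * (sg * a + eps) + 2 * r ^+ 2)).
Proof.
move=> sg2 /andP[r0 r1] Z'_le.
have s_ge : - 2^-1 <= sg * r.
  by have [/eqP ->|/eqP ->] : (sg == 1) \/ (sg == -1);
    [apply/orP; rewrite -sqrf_eq1 sg2 | lra | lra].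
have s1 : 0 <= 1 + sg * r by lra.
set e := r * (sg * a + eps) - 2 * r ^+ 2.
have -> : theta - r * (sg * a + eps) + 2 * r ^+ 2 = theta - e by rewrite /e; ring.
apply: (@le_trans _ _ (Zpart G (tilt k (sg * r)) * expR (- (N * e)) / Zpart G lam)).
  rewrite p_probE /Zpart !mulr_suml; apply: ler_sum => phi _.
  rewrite col_weight_tilt /p_mass [leLHS]mulrAC -/(Zpart G lam) ler_wpM2r ?invr_ge0 ?(ltW Z_gt0) //.
  rewrite -mulrA ler_wpM2l ?prodr_ge0 // => [v _|]; first exact: ltW.
  have [dev|_] := lerP (sg * a + eps) (sg * col_share R k phi); last by rewrite mulr_ge0 ?exprn_ge0 ?expR_ge0.
  set n := #|_|.
  have share : n%:R = N * col_share R k phi.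
    have [G0|G0] := posnP #|G|; last by rewrite mulrC divfK // pnatr_eq0 -lt0n.
    rewrite /N G0 mul0r; apply/eqP; rewrite pnatr_eq0 -leqn0 -G0.
    exact: max_card.
  apply: (@le_trans _ _ (expR (sg * r - 2 * (sg * r) ^+ 2) ^+ n * expR (- (N * e)))).
    rewrite -expRM_natl -expRD -[leLHS]expR0 ler_expR share.
    rewrite exprMn sg2 mul1r.
    have -> : N * col_share R k phi * (sg * r - 2 * r ^+ 2) - N * e =
      N * (r * (sg * col_share R k phi - (sg * a + eps))
           + 2 * r ^+ 2 * (1 - col_share R k phi)) by rewrite /e; ring.
    rewrite mulr_ge0 // addr_ge0 // mulr_ge0 ?subr_ge0 ?col_share_le1 //.
      exact: ltW.
    by rewrite mulr_ge0 // sqr_ge0.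
  rewrite ler_wpM2r ?expR_ge0 //; apply: lerXn2r; rewrite ?nnegrE ?expR_ge0 //.
  exact: expR_le_1Ds.
rewrite ler_pdivrMr // (_ : N * (theta - e) = N * theta - N * e); last by ring.
rewrite expRD [leRHS]mulrC mulrA.
by rewrite ler_wpM2r ?expR_ge0.
Qed.

Section Concentration.
Variables (k : H) (a b eps : R).
Hypotheses (a_le1 : a <= 1) (b_ge0 : 0 <= b) (eps_ge0 : 0 <= eps).
Hypotheses
  (upper_tail : p_prob lam (fun phi : {ffun G -> H} =>
     1 * b + eps <= 1 * col_share R k phi) <= eps)
  (lower_tail : p_prob lam (fun phi : {ffun G -> H} =>
     -1 * a + eps <= -1 * col_share R k phi) <= eps).

Lemma p_prob_outside_le (E : pred {ffun G -> H}) :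
    (forall phi, E phi ->
       (b + eps <= col_share R k phi) || (col_share R k phi <= a - eps)) ->
  p_prob lam E <= 2 * eps.
Proof.
move=> imp.
apply: le_trans (_ : _ <= eps + eps) _; last by rewrite -mulr2n mulr_natl.
apply: le_trans _ (lerD upper_tail lower_tail).
rewrite !p_probE -big_split; apply: ler_sum => phi _ /=.
rewrite -mulrDr ler_wpM2l ?p_mass_ge0 // !mul1r !mulN1r.
case Ephi: (E phi); last by rewrite addr_ge0.
case/orP: (imp phi Ephi) => [->|le]; first by rewrite lerDl.
have -> : (- a + eps <= - col_share R k phi) by lra.
by rewrite lerDr.
Qed.

Lemma p_prob_inside_ge (E : pred {ffun G -> H}) :
    (forall phi, a - eps < col_share R k phi < b + eps -> E phi) ->
  1 - 2 * eps <= p_prob lam E.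
Proof.
move=> imp; rewrite lerBlDr addrC -lerBlDr -[X in X - _]sum_p_mass.
have -> : \sum_(phi in Defs.Hom G H) p_mass lam phi - p_prob lam E
    = p_prob lam (predC E).
  rewrite !p_probE -sumrB; apply: eq_bigr => phi _ /=.
  by case: (E phi); rewrite ?mulr1 ?mulr0 ?subrr ?subr0.
apply: p_prob_outside_le => phi /=; apply: contraNT; rewrite negb_or -!ltNge.
by move=> /andP[? ?]; apply: imp; apply/andP; split.
Qed.

Lemma p_bar_bounds : a - 2 * eps <= p_bar G lam k <= b + 2 * eps.
Proof.
rewrite p_barE; apply/andP; split.
- apply: le_trans (_ : _ <= (a - eps) - eps) _; first by lra.
  apply: (@le_trans _ _ ((a - eps) + \sum_(phi in Defs.Hom G H) p_mass lam phi *
      - (-1 * a + eps <= -1 * col_share R k phi)%R%:R)).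
    rewrite lerD2l; under eq_bigr => phi _ do rewrite mulrN.
    by rewrite sumrN lerN2 -p_probE.
  rewrite -p_expect_affine; apply: le_p_expect => phi.
  rewrite !mulN1r; have := col_share_ge0 k phi.
  move: (col_share R k phi) => x x0.
  have [?|?] := lerP (- a + eps) (- x).
    by have : a - eps - 1 <= x by move: a_le1 eps_ge0; lra.
  by have : a - eps - 0 <= x by lra.
- apply: le_trans (_ : _ <= (b + eps) + eps) _; last by lra.
  apply: le_trans _ (lerD (lexx _) upper_tail).
  rewrite p_probE -p_expect_affine; apply: le_p_expect => phi; rewrite !mul1r.
  have := col_share_le1 k phi; move: (col_share R k phi) => x x1.
  have [?|?] := lerP (b + eps) x.
    by have : x <= b + eps + 1 by move: b_ge0 eps_ge0; lra.
  by have : x <= b + eps + 0 by lra.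
Qed.

End Concentration.
End Colouring.

(** The linear terms of the exponent in [tilt_tail] cancel; a small [r] makes
    the remaining quadratic error negligible against [r * eps]. *)
Lemma tail_parameters (R : realType) (eps M : R) (n : nat) : 0 < eps -> 0 <= M ->
  exists r delta : R, [/\ 0 < r <= 2^-1, r * n%:R <= 1, 0 < delta &
    exists n0 : nat, forall N, (n0 <= N)%N ->
      expR (N%:R * (M * r ^+ 2 + delta - r * eps + 2 * r ^+ 2)) <= eps].
Proof.
move=> eps0 M0.
(* With [r = B^-1] one gets [r <= 1/2], [r * n <= 1] and [(M + 2) * r <= eps / 4]. *)
pose B : R := 2 + n%:R + 4 * (M + 2) / eps.
have B2 : 0 <= 4 * (M + 2) / eps by rewrite divr_ge0 ?(ltW eps0) //; lra.
have B0 : 0 < B by rewrite /B; have := ler0n R n; lra.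
pose r := B^-1; have r0 : 0 < r by rewrite invr_gt0.
exists r, (r * eps / 4); split.
- rewrite r0 /r lef_pV2 ?posrE //; first by rewrite /B; have := ler0n R n; lra.
- rewrite mulrC ler_pdivrMr // mul1r /B; lra.
- by rewrite divr_gt0 // mulr_gt0.
pose x : R := r * eps / 2; have x0 : 0 < x by rewrite divr_gt0 ?mulr_gt0.
exists (Num.truncn (eps * x)^-1).+1 => N leN.
have Nx : eps^-1 <= N%:R * x.
  have : (eps * x)^-1 <= N%:R.
    apply: ltW; apply: lt_le_trans (_ : _ < (Num.truncn (eps * x)^-1).+1%:R) _.
      exact: truncnS_gt.
    by rewrite ler_nat.
  by rewrite invfM ler_pdivrMr.
apply: (@le_trans _ _ (expR (- (N%:R * x)))).
  rewrite ler_expR -[leRHS]mulrN; apply: ler_wpM2l => //.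
  have : (M + 2) * r <= eps / 4.
    rewrite /r ler_pdivrMr // /B.
    have -> : eps / 4 * (2 + n%:R + 4 * (M + 2) / eps)
       = eps / 4 * (2 + n%:R) + (M + 2).
      by field; rewrite gt_eqF.
    by rewrite lerDr mulr_ge0 ?addr_ge0 ?divr_ge0 ?(ltW eps0).
  move=> /(ler_wpM2l (ltW r0)); rewrite /x expr2; lra.
rewrite expRN -[leRHS]invrK lef_pV2 ?posrE ?expR_gt0 ?invr_gt0 //.
apply: le_trans Nx _; apply: le_trans (expR_ge1Dx _); lra.
Qed.

(** * Optimal pairs of colour sets *)

Section Extrema.
Variable R : realType.
Implicit Types s : seq R.

Lemma list_max_ge s x : x \in s -> x <= list_max s.
Proof.
rewrite /list_max; elim: s (head 0 s) => // y s IHs z.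
rewrite big_cons inE le_max => /orP[/eqP ->|/IHs ->]; last by rewrite orbT.
by rewrite lexx.
Qed.

Lemma list_min_le s x : x \in s -> list_min s <= x.
Proof.
rewrite /list_min; elim: s (head 0 s) => // y s IHs z.
rewrite big_cons inE ge_min => /orP[/eqP ->|/IHs ->]; last by rewrite orbT.
by rewrite lexx.
Qed.

Lemma list_max_mem s x : x \in s -> list_max s \in s.
Proof.
case: s => // y s _; rewrite /list_max /=.
suff main t : \big[Num.max/y]_(z <- t) z \in y :: t.
  by have := main (y :: s); rewrite !inE orbA orbb.
elim: t => [|z t IHt]; first by rewrite big_nil inE.
rewrite big_cons inE maxEle; case: ifP => _; last by rewrite inE eqxx orbT.
by move: IHt; rewrite !inE => /orP[->|->]; rewrite ?orbT.
Qed.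

End Extrema.

Section Optimum.
Variables (R : realType) (H : graph) (lam : H -> R).
Hypotheses (lam_gt0 : forall i, 0 < lam i) (H_edge : has_edge H).

Let wprod (AB : {set H} * {set H}) := set_weight lam AB.1 * set_weight lam AB.2.

Lemma joined_le_eta (A B : {set H}) :
  joined A B -> set_weight lam A * set_weight lam B <= eta lam.
Proof.
move=> AB; apply: list_max_ge; apply/fintype.imageP.
by exists (A, B); rewrite // inE.
Qed.

Lemma joined_edge (i j : H) : adj i j -> joined [set i] [set j].
Proof.
move=> ij; apply/forall_inP => u /set1P ->.
by apply/forall_inP => v /set1P ->.
Qed.

Lemma eta_gt0 : 0 < eta lam.
Proof.
have [i [j ij]] := H_edge.
apply: lt_le_trans (joined_le_eta (joined_edge ij)).
by rewrite /set_weight !big_set1 mulr_gt0.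
Qed.

Lemma opt_pairsP (AB : {set H} * {set H}) : AB \in opt_pairs lam ->
  joined AB.1 AB.2 /\ set_weight lam AB.1 * set_weight lam AB.2 = eta lam.
Proof. by rewrite inE => /andP[? /eqP ?]. Qed.

Lemma opt_pair_exists : exists AB, AB \in opt_pairs lam.
Proof.
have [i [j ij]] := H_edge.
have : eta lam \in [seq set_weight lam AB.1 * set_weight lam AB.2
    | AB in [set AB : {set H} * {set H} | joined AB.1 AB.2]].
  apply: (@list_max_mem _ _ (wprod ([set i], [set j]))); apply/fintype.imageP.
  by exists ([set i], [set j]); rewrite // inE joined_edge.
case/fintype.imageP => AB; rewrite inE => AB_joined etaE.
by exists AB; rewrite inE AB_joined etaE eqxx.
Qed.

Let eta2_gt0 : 0 < 2 * eta lam. Proof. by rewrite mulr_gt0 // eta_gt0. Qed.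

Lemma pair_value_le_a_plus k AB : AB \in opt_pairs lam ->
  pair_value lam k AB <= 2 * eta lam * a_plus lam k.
Proof.
move=> AB_opt; rewrite mulrC divfK ?gt_eqF //.
by apply: list_max_ge; apply/fintype.imageP; exists AB.
Qed.

Lemma pair_value_ge_a_minus k AB : AB \in opt_pairs lam ->
  2 * eta lam * a_minus lam k <= pair_value lam k AB.
Proof.
move=> AB_opt; rewrite mulrC divfK ?gt_eqF //.
by apply: list_min_le; apply/fintype.imageP; exists AB.
Qed.

Lemma pair_value_ge0 k AB : 0 <= pair_value lam k AB.
Proof.
by rewrite addr_ge0 // !mulr_ge0 ?set_weight_ge0 // ltW.
Qed.

Lemma a_plus_ge0 k : 0 <= a_plus lam k.
Proof.
have [AB AB_opt] := opt_pair_exists.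
rewrite -(pmulr_rge0 _ eta2_gt0).
exact: le_trans (pair_value_ge0 k AB) (pair_value_le_a_plus k AB_opt).
Qed.

Lemma a_minus_le1 k : a_minus lam k <= 1.
Proof.
have [AB AB_opt] := opt_pair_exists.
rewrite -(ler_pM2l eta2_gt0) mulr1.
apply: le_trans (pair_value_ge_a_minus k AB_opt) _.
have [_ <-] := opt_pairsP AB_opt; rewrite mulr_natl mulr2n.
have part (A B : {set H}) : set_weight lam A * lam k * (k \in B)%:R
    <= set_weight lam A * set_weight lam B.
  rewrite -mulrA ler_wpM2l ?set_weight_ge0 //.
  have [kB|_] := boolP (k \in B); rewrite ?mulr0 ?set_weight_ge0 //.
  by rewrite mulr1 le_set_weight.
by apply: lerD; last rewrite [leRHS]mulrC; exact: part.
Qed.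

(** First-order expansion of the maximum: optimal pairs grow at a rate at most
    [2 * a], and the other ones start a positive distance below [eta]. *)
Lemma tilted_optimum k (sg a : R) : sg ^+ 2 = 1 ->
    (forall AB, AB \in opt_pairs lam ->
       sg * pair_value lam k AB <= sg * (2 * eta lam * a)) ->
  exists n : nat, forall r, 0 < r -> r * n%:R <= 1 -> forall A B, joined A B ->
    set_weight (tilt lam k (sg * r)) A * set_weight (tilt lam k (sg * r)) B
      <= eta lam * (1 + (2 * (sg * r * a) + lam k ^+ 2 / eta lam * r ^+ 2)).
Proof.
move=> sg2 opt_le.
suff /fin_all_exists[n nP] : forall AB : {set H} * {set H}, exists n : nat,
    forall r, 0 < r -> r * n%:R <= 1 -> joined AB.1 AB.2 ->
    wprod AB + r * (sg * pair_value lam k AB)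
      <= eta lam + r * (sg * (2 * eta lam * a)).
  exists (\max_AB n AB)%N => r r0 rn A B AB.
  have {}rn : r * (n (A, B))%:R <= 1.
    by apply: le_trans rn; rewrite ler_wpM2l ?(ltW r0) // ler_nat leq_bigmax.
  have := nP (A, B) r r0 rn AB; rewrite /wprod /pair_value /= => le.
  rewrite !set_weight_tilt.
  have sq : (sg * r) ^+ 2 * lam k ^+ 2 * ((k \in A)%:R * (k \in B)%:R)
      <= r ^+ 2 * lam k ^+ 2.
    rewrite exprMn sg2 mul1r ler_piMr ?(mulr_ge0 (sqr_ge0 _) (sqr_ge0 _)) //.
    by rewrite -natrM (ler_nat _ _ 1) mulnb leq_b1.
  apply: le_trans (_ : _ <= eta lam + r * (sg * (2 * eta lam * a))
    + r ^+ 2 * lam k ^+ 2) _; last first.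
    rewrite le_eqVlt; apply/orP; left; apply/eqP; field.
    by rewrite gt_eqF // eta_gt0.
  apply: le_trans _ (lerD le sq); rewrite le_eqVlt; apply/orP; left; apply/eqP.
  by ring.
move=> AB; have [AB_opt|AB_nopt] := boolP (AB \in opt_pairs lam).
  exists 0%N => r r0 _ _; have [_ ABe] := opt_pairsP AB_opt.
  by rewrite /wprod ABe lerD2l ler_wpM2l ?opt_le // ltW.
have [AB_joined|] := boolP (joined AB.1 AB.2); last by exists 0%N.
have gap : 0 < eta lam - wprod AB.
  rewrite subr_gt0 lt_neqAle joined_le_eta // andbT.
  by move: AB_nopt; rewrite inE AB_joined.
pose d := `|sg * pair_value lam k AB - sg * (2 * eta lam * a)|.
exists (Num.truncn (d / (eta lam - wprod AB))).+1 => r r0 rn _.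
have dn : d / (eta lam - wprod AB) <= (Num.truncn (d / (eta lam - wprod AB))).+1%:R.
  exact/ltW/truncnS_gt.
have rd : r * d <= eta lam - wprod AB.
  have : r * (d / (eta lam - wprod AB)) <= 1.
    by apply: le_trans rn; rewrite ler_wpM2l // ltW.
  by rewrite mulrA ler_pdivrMr // mul1r.
have : r * (sg * pair_value lam k AB - sg * (2 * eta lam * a)) <= r * d.
  by rewrite ler_wpM2l ?ler_norm // ltW.
lra.
Qed.

End Optimum.

Lemma sgn_ge_N1 (R : realType) (sg r : R) :
  sg ^+ 2 = 1 -> 0 < r <= 2^-1 -> -1 < sg * r.
Proof.
move=> /eqP; rewrite sqrf_eq1 => /orP[/eqP ->|/eqP ->] /andP[? ?]; lra.
Qed.

Lemma expRN_lower_bound (R : realType) (I : finType) (x : I -> R) :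
  (forall i, 0 < x i) -> exists2 L, 0 <= L & forall i, expR (- L) <= x i.
Proof.
move=> x_gt0; exists (\sum_i `|ln (x i)|); first exact: sumr_ge0.
move=> i; rewrite -[leRHS]lnK ?posrE // ler_expR lerNl.
apply: (@le_trans _ _ `|ln (x i)|); first by rewrite -normrN ler_norm.
by rewrite (bigD1 i) //= lerDl sumr_ge0.
Qed.

Lemma nat_upper_bound (R : realType) (x : R) : exists n : nat, x <= n%:R.
Proof. by exists (Num.truncn x).+1; exact/ltW/truncnS_gt. Qed.

(** * Tails of the colour shares in dense and sparse graphs *)

Section Tails.
Variables (R : realType) (H : graph) (lam : H -> R).
Hypotheses (lam_gt0 : forall i, 0 < lam i) (H_edge : has_edge H).

(** Colour one class from [A] and the other from [B], for an optimal [(A, B)]. *)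
Lemma Zpart_ge_eta (G : graph) (c : G -> bool) : proper c -> balanced c ->
  eta lam ^+ #|[set v | c v]| <= Zpart G lam.
Proof.
move=> c_proper bal; have [[A B] /opt_pairsP[/= AB <-]] := opt_pair_exists lam H_edge.
pose S v := if c v then A else B.
apply: le_trans (Zpart_ge lam_gt0 (S := S) _); last first.
  move=> u v /c_proper; rewrite /S; case: (c u); case: (c v) => // _.
  apply/forall_inP => x xB; apply/forall_inP => y yA; rewrite adj_sym.
  exact: (forall_inP (forall_inP AB _ yA)).
rewrite (bigID c) /= exprMn {2}bal -!prodr_const.
apply: ler_pM; [by apply: prodr_ge0 => v _; exact: set_weight_ge0
  |by apply: prodr_ge0 => v _; exact: set_weight_ge0| |].
  rewrite le_eqVlt; apply/orP; left; apply/eqP.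
  by apply: eq_big => v; rewrite inE // /S => ->.
rewrite le_eqVlt; apply/orP; left; apply/eqP.
by apply: eq_big => v; rewrite inE // /S => /negbTE ->.
Qed.

(** The partition function of a nearly [D]-regular bipartite graph is
    [eta ^ (#|G| / 2)] up to a subexponential factor, also for the tilted
    activities; comparing the two gives the tail bound. *)
Lemma dense_tail (eps : R) (k : H) (sg a : R) : 0 < eps -> sg ^+ 2 = 1 ->
    (forall AB, AB \in opt_pairs lam ->
       sg * pair_value lam k AB <= sg * (2 * eta lam * a)) ->
  exists M : nat, forall (G : graph) (c : G -> bool) (D : nat),
    proper c -> balanced c -> (0 < D)%N -> (M <= #|G|)%N -> (M <= D)%N ->
    M%:R * (\sum_(v : G) `|(degree v)%:R - D%:R|) <= D%:R * #|G|%:R :> R ->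
    p_prob lam (fun phi : {ffun G -> H} => sg * a + eps <= sg * col_share R k phi)
      <= eps.
Proof.
move=> eps0 sg2 opt_le; have [n nP] := tilted_optimum lam_gt0 H_edge sg2 opt_le.
have eta0 := eta_gt0 lam_gt0 H_edge.
set M0 : R := lam k ^+ 2 / eta lam in nP.
have M0_ge0 : 0 <= M0 by rewrite divr_ge0 ?sqr_ge0 // ltW.
have [r [delta [r_bd rn delta0 [n0 n0P]]]] := tail_parameters n eps0 M0_ge0.
have r0 : 0 < r by case/andP: r_bd.
set mu := tilt lam k (sg * r).
have mu_gt0 i : 0 < mu i by apply: tilt_gt0 => //; exact: sgn_ge_N1.
have W_gt0 := total_weight_gt0 mu_gt0 H_edge.
set K := eta lam * (1 + (2 * (sg * r * a) + M0 * r ^+ 2)).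
have K_joined A B : joined A B -> set_weight mu A * set_weight mu B <= K.
  exact: nP.
have K_gt0 : 0 < K.
  have [i [j ij]] := H_edge; apply: lt_le_trans (K_joined _ _ (joined_edge ij)).
  by rewrite /set_weight !big_set1 mulr_gt0.
(* One [L] serves all the colours and, as the value at [None], also [K]. *)
have [L L_ge0 L_le] := expRN_lower_bound
  (x := fun o : option H => if o is Some i then mu i / total_weight mu
                            else K / total_weight mu ^+ 2)
  (fun o => match o with Some i => divr_gt0 (mu_gt0 i) W_gt0
                       | None => divr_gt0 K_gt0 (exprn_gt0 2 W_gt0) end).
(* [M1] absorbs the number of subsets of [H], [M2] the irregular degrees. *)
have [M1 M1P] := nat_upper_bound (#|H|%:R / delta).
have [M2 M2P] := nat_upper_bound (2 * L / delta).
exists (n0 + (M1 + M2))%N => G c D c_proper bal D0 MG MD MDelta.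
set m := #|[set v | c v]|; have GE : #|G| = (m + m)%N by exact: balanced_card.
have Z_ge : eta lam ^+ m <= Zpart G lam by exact: Zpart_ge_eta.
have Z_gt0 : 0 < Zpart G lam by apply: lt_le_trans Z_ge; exact: exprn_gt0.
pose theta := sg * r * a + M0 * r ^+ 2 + delta.
apply: le_trans (@tilt_tail _ _ _ _ lam_gt0 Z_gt0 k sg r a eps theta sg2 r_bd _) _; last first.
  have -> : theta - r * (sg * a + eps) + 2 * r ^+ 2
    = M0 * r ^+ 2 + delta - r * eps + 2 * r ^+ 2 by rewrite /theta; ring.
  by apply: n0P; exact: leq_trans (leq_addr _ _) MG.
have Z'_le := bipartite_Zpart_le mu_gt0 H_edge c_proper D0 K_joined L_ge0
  (fun i => L_le (Some i)) (L_le None) bal (erefl m).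
rewrite -(@ler_pXn2r _ D) // ?nnegrE; last 2 first.
- by apply: sumr_ge0 => phi _; apply: prodr_ge0 => v _; exact: ltW.
- by rewrite mulr_ge0 ?expR_ge0 // ltW.
apply: le_trans Z'_le _; rewrite [leRHS]exprMn [leLHS]mulrC.
have K_le : K ^+ (m * D) <= eta lam ^+ (m * D)
    * expR ((m * D)%:R * (2 * (sg * r * a) + M0 * r ^+ 2)).
  rewrite expRM_natl -exprMn; apply: lerXn2r; rewrite ?nnegrE ?(ltW K_gt0) //.
    by rewrite mulr_ge0 ?expR_ge0 // ltW.
  by rewrite /K ler_wpM2l ?(ltW eta0) // expR_ge1Dx.
apply: le_trans (ler_wpM2r (expR_ge0 _) K_le) _.
rewrite -[leLHS]mulrA -expRD; apply: ler_pM; rewrite ?expR_ge0 ?exprn_ge0 ?(ltW eta0) //.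
  rewrite exprM; apply: lerXn2r; rewrite ?nnegrE ?exprn_ge0 ?(ltW eta0) //.
  exact: ltW.
rewrite -expRM_natl ler_expR.
set Delta := \sum_v _ in MDelta *.
have m0 : 0 <= m%:R :> R by [].
have D0' : 0 <= D%:R :> R by [].
have DN0 : 0 <= D%:R * m%:R :> R by rewrite mulr_ge0.
have Delta0 : 0 <= Delta by apply: sumr_ge0 => v _.
have hD : #|H|%:R * m%:R <= delta * (D%:R * m%:R).
  rewrite mulrA ler_wpM2r //.
  have : M1%:R <= D%:R :> R.
    by rewrite ler_nat (leq_trans _ MD) // addnCA leq_addr.
  move=> /(le_trans M1P); rewrite ler_pdivrMr // => le; apply: le_trans le _.
  by rewrite mulrC.
have LD : L * Delta <= delta * (D%:R * m%:R).
  have step : 2 * L / delta * Delta <= D%:R * #|G|%:R.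
    apply: le_trans MDelta; rewrite ler_wpM2r //; apply: le_trans M2P _.
    by rewrite ler_nat addnA leq_addl.
  have : 2 * L / delta * Delta * delta <= D%:R * #|G|%:R * delta.
    by rewrite ler_wpM2r // ltW.
  have -> : 2 * L / delta * Delta * delta = 2 * (L * Delta).
    by field; rewrite gt_eqF.
  rewrite GE natrD.
  have -> : D%:R * (m%:R + m%:R) * delta = 2 * (delta * (D%:R * m%:R)) by ring.
  lra.
have quad : 0 <= M0 * r ^+ 2 * (D%:R * m%:R).
  by rewrite mulr_ge0 // mulr_ge0 // sqr_ge0.
rewrite GE natrD natrM /theta -subr_ge0.
have -> : D%:R * ((m%:R + m%:R) * (sg * r * a + M0 * r ^+ 2 + delta))
   - (m%:R * D%:R * (2 * (sg * r * a) + M0 * r ^+ 2) + (#|H|%:R * m%:R + L * Delta))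
   = M0 * r ^+ 2 * (D%:R * m%:R) + (delta * (D%:R * m%:R) - #|H|%:R * m%:R)
     + (delta * (D%:R * m%:R) - L * Delta) by ring.
by rewrite addr_ge0 ?subr_ge0 // addr_ge0 ?subr_ge0.
Qed.

(** Isolated vertices are coloured freely, and the others can follow a fixed edge
    of [H]; their number is at most the sum of the degrees. *)
Lemma sparse_Zpart_ge : exists2 L : R, 0 <= L &
  forall (G : graph) (c : G -> bool), proper c ->
    total_weight lam ^+ #|G| <=
      Zpart G lam * expR (L * \sum_(v : G) (degree v)%:R).
Proof.
have W_gt0 := total_weight_gt0 lam_gt0 H_edge.
have [L L_ge0 L_le] := expRN_lower_bound
  (fun i => divr_gt0 (lam_gt0 i) W_gt0).
exists L => // G c c_proper; have [i [j ij]] := H_edge.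
pose S v : {set H} := if degree v == 0%N then finset.setT else
                      if c v then [set i] else [set j].
have S_joined u v : adj u v -> joined (S u) (S v).
  have deg_neq0 (u' v' : G) : adj u' v' -> (degree u' == 0%N) = false.
    by move=> uv; apply/negbTE; rewrite cards_eq0; apply/set0Pn; exists v'; rewrite inE.
  move=> uv; have := c_proper _ _ uv.
  rewrite /S (deg_neq0 _ _ uv) (deg_neq0 v u); last by rewrite adj_sym.
  by case: (c u); case: (c v) => // _; apply: joined_edge; rewrite // adj_sym.
rewrite -ler_pdivrMr ?expR_gt0 // -expRN.
apply: le_trans (Zpart_ge lam_gt0 S_joined).
rewrite mulr_sumr -sumrN expR_sum -prodr_const -big_split /=.
apply: ler_prod => v _; rewrite mulr_ge0 ?expR_ge0 ?(ltW W_gt0) //=.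
have [deg0|deg_neq0] := eqVneq (degree v) 0%N.
  by rewrite /S deg0 eqxx mulr0 oppr0 expR0 mulr1.
have one l : lam l >= total_weight lam * expR (- (L * (degree v)%:R)).
  have := L_le l; rewrite ler_pdivlMr // mulrC; apply: le_trans.
  rewrite ler_wpM2l ?(ltW W_gt0) // ler_expR lerN2 ler_peMr //.
  by rewrite (ler_nat _ 1) lt0n.
by rewrite /S (negbTE deg_neq0); case: (c v); rewrite /set_weight big_set1.
Qed.

(** Both partition functions are, up to a subexponential factor, those of the
    graph without edges. *)
Lemma sparse_tail (eps : R) (k : H) (sg : R) : 0 < eps -> sg ^+ 2 = 1 ->
  exists M : nat, forall (G : graph) (c : G -> bool),
    proper c -> (M <= #|G|)%N ->
    M%:R * (\sum_(v : G) (degree v)%:R) <= #|G|%:R :> R ->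
    p_prob lam (fun phi : {ffun G -> H} =>
        sg * (lam k / total_weight lam) + eps <= sg * col_share R k phi)
      <= eps.
Proof.
move=> eps0 sg2; have [L L_ge0 Z_ge] := sparse_Zpart_ge.
have [r [delta [r_bd _ delta0 [n0 n0P]]]] := tail_parameters 0 eps0 (lexx 0).
have W_gt0 := total_weight_gt0 lam_gt0 H_edge.
have [M1 M1P] := nat_upper_bound (L / delta).
set a := lam k / total_weight lam.
set mu := tilt lam k (sg * r).
have mu_gt0 i : 0 < mu i by apply: tilt_gt0 => //; exact: sgn_ge_N1.
exists (n0 + M1)%N => G c c_proper MG Mdeg.
have := Z_ge G c c_proper; set deg := \sum_v _ in Mdeg * => {}Z_ge.
have Z_gt0 : 0 < Zpart G lam.
  by rewrite -(pmulr_lgt0 _ (expR_gt0 (L * deg))) (lt_le_trans _ Z_ge) ?exprn_gt0.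
pose theta := sg * r * a + delta.
apply: le_trans (@tilt_tail _ _ _ _ lam_gt0 Z_gt0 k sg r a eps theta sg2 r_bd _) _; last first.
  have -> : theta - r * (sg * a + eps) + 2 * r ^+ 2
    = 0 * r ^+ 2 + delta - r * eps + 2 * r ^+ 2 by rewrite /theta; ring.
  by apply: n0P; exact: leq_trans (leq_addr _ _) MG.
apply: le_trans (Zpart_le_total G mu_gt0) _.
have WE : total_weight mu = total_weight lam * (1 + sg * r * a).
  rewrite /total_weight set_weight_tilt inE mulr1 -/(total_weight lam) /a.
  by field; rewrite gt_eqF.
have factor_ge0 : 0 <= 1 + sg * r * a.
  by rewrite -(pmulr_rge0 _ W_gt0) -WE; apply/ltW/total_weight_gt0.
rewrite WE.
rewrite /theta [in leRHS]mulrDr expRD [leRHS]mulrA [leRHS]mulrAC exprMn; apply: ler_pM.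
- by rewrite exprn_ge0 // ltW.
- exact: exprn_ge0.
- apply: le_trans Z_ge _; rewrite ler_wpM2l ?(ltW Z_gt0) // ler_expR.
  have deg0 : 0 <= deg by apply: sumr_ge0 => v _.
  have : L / delta * deg <= #|G|%:R.
    apply: le_trans Mdeg; rewrite ler_wpM2r //; apply: le_trans M1P _.
    by rewrite ler_nat leq_addl.
  by rewrite mulrAC ler_pdivrMr.
- rewrite expRM_natl; apply: lerXn2r; rewrite ?nnegrE ?expR_ge0 ?expR_ge1Dx //.
Qed.

End Tails.

(** * Moments of the degrees under edge percolation *)

Section EdgePercolation.
Variables (R : realType) (G : graph) (p : R).
Hypothesis p01 : 0 <= p <= 1.

Implicit Types F : {set {set G}}.

Definition edge_mean (X : {set {set G}} -> R) : R :=
  \sum_(F : {set {set G}} | F \subset edges G) edge_law p F * X F.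

Lemma edge_law_ge0 F : 0 <= edge_law p F.
Proof.
have [p0 p1] := andP p01; apply: prodr_ge0 => e _.
by case: ifP => // _; rewrite subr_ge0.
Qed.

Lemma prob_subgraph_ge0 E : 0 <= prob_subgraph G p E.
Proof. by apply: sumr_ge0 => F _; exact: edge_law_ge0. Qed.

Lemma le_edge_mean X Y : (forall F, X F <= Y F) -> edge_mean X <= edge_mean Y.
Proof.
by move=> le; apply: ler_sum => F _; rewrite ler_wpM2l ?edge_law_ge0.
Qed.

Lemma edge_mean_sum (J : finType) (P : pred J) (X : J -> {set {set G}} -> R) :
  edge_mean (fun F => \sum_(j | P j) X j F) = \sum_(j | P j) edge_mean (X j).
Proof.
by rewrite exchange_big; apply: eq_bigr => F _; rewrite mulr_sumr.
Qed.

Lemma edge_meanD X Y : edge_mean (fun F => X F + Y F) = edge_mean X + edge_mean Y.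
Proof. by rewrite -big_split; apply: eq_bigr => F _; rewrite mulrDr. Qed.

Lemma edge_meanZ a X : edge_mean (fun F => a * X F) = a * edge_mean X.
Proof. by rewrite mulr_sumr; apply: eq_bigr => F _; rewrite mulrCA. Qed.

(** The retained edges are independent; all moments below are instances. *)
Lemma edge_mean_prod (u w : {set G} -> R) :
  edge_mean (fun F => \prod_(e in edges G) (if e \in F then u e else w e))
  = \prod_(e in edges G) (p * u e + (1 - p) * w e).
Proof.
pose U e := if e \in edges G then p * u e else 0.
pose V e := if e \in edges G then (1 - p) * w e else 1.
transitivity (\prod_e (U e + V e)); last first.
  rewrite [RHS]big_mkcond; apply: eq_bigr => e _.
  by rewrite /U /V; case: ifP => _; rewrite ?add0r.
rewrite bigA_distr /edge_mean big_mkcond; apply: eq_bigr => F _.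
case: ifP => [FE|/negbT /fintype.subsetPn[e eF eE]]; last first.
  by rewrite (bigD1 e) //= eF /U (negbTE eE) mul0r.
rewrite /edge_law -big_split big_mkcond; apply: eq_bigr => e _ /=.
rewrite /U /V; have [eE|eE] := boolP (e \in edges G); first by case: ifP.
by case: ifP => // /(fintype.subsetP FE); rewrite (negbTE eE).
Qed.

Lemma edge_mean_cst a : edge_mean (fun=> a) = a.
Proof.
transitivity (edge_mean (fun F => a * \prod_(e in edges G)
    (if e \in F then (fun=> 1) e else (fun=> 1) e))).
  by apply: eq_bigr => F _; rewrite big1 ?mulr1 // => e _; case: ifP.
rewrite edge_meanZ edge_mean_prod big1 ?mulr1 // => e _; ring.
Qed.

Lemma prob_subgraph_markov (E : graph -> bool) (X : {set {set G}} -> R) (t : R) :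
    0 < t -> (forall F, 0 <= X F) -> (forall F, X F <= t -> E (subgraph F)) ->
  1 - edge_mean X / t <= prob_subgraph G p E.
Proof.
move=> t0 X0 XE; rewrite lerBlDr -{1}(edge_mean_cst 1).
rewrite mulrC -edge_meanZ /prob_subgraph big_mkcondr -big_split /=.
apply: ler_sum => F _; rewrite mulr1.
have term0 : 0 <= edge_law p F * (t^-1 * X F).
  by rewrite mulr_ge0 ?edge_law_ge0 // mulr_ge0 // invr_ge0 ltW.
case: ifP => EF; first by rewrite lerDl.
rewrite add0r ler_peMr ?edge_law_ge0 // mulrC ler_pdivlMr // mul1r.
have [/XE|/ltW //] := lerP (X F) t; by rewrite EF.
Qed.

Definition centered (e : {set G}) F : R := (e \in F)%:R - p.

Lemma centered_prod e F : e \in edges G ->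
  centered e F = \prod_(e' in edges G)
    (if e' \in F then (if e' == e then 1 - p else 1)
     else (if e' == e then - p else 1)).
Proof.
move=> eE; rewrite (bigD1 e) //= eqxx big1 ?mulr1 => [|e' /andP[_ /negbTE ->]].
  by rewrite /centered; case: ifP => _; rewrite ?sub0r.
by case: ifP.
Qed.

Lemma edge_mean_centered e : e \in edges G -> edge_mean (centered e) = 0.
Proof.
move=> eE; transitivity (edge_mean (fun F => \prod_(e' in edges G)
    (if e' \in F then (if e' == e then 1 - p else 1)
     else (if e' == e then - p else 1)))).
  by apply: eq_bigr => F _; rewrite centered_prod.
rewrite (edge_mean_prod (fun e' => if e' == e then 1 - p else 1)
  (fun e' => if e' == e then - p else 1)).
by rewrite (bigD1 e) //= eqxx (_ : p * (1 - p) + _ = 0) ?mul0r //; ring.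
Qed.

Lemma edge_mean_centered2 e e' : e \in edges G -> e' \in edges G ->
  edge_mean (fun F => centered e F * centered e' F) = p * (1 - p) * (e == e')%:R.
Proof.
move=> eE e'E.
pose u (e0 f : {set G}) : R := if f == e0 then 1 - p else 1.
pose w (e0 f : {set G}) : R := if f == e0 then - p else 1.
transitivity (edge_mean (fun F => \prod_(f in edges G)
    (if f \in F then (fun f => u e f * u e' f) f else (fun f => w e f * w e' f) f))).
  apply: eq_bigr => F _; rewrite !centered_prod // -big_split /=.
  by congr (_ * _); apply: eq_bigr => f _; case: ifP.
rewrite edge_mean_prod (bigD1 e) //= /u /w eqxx.
have [<-|ne] := eqVneq e e'; last by rewrite [X in X * _](_ : _ = 0) ?mul0r ?mulr0 //; ring.
rewrite big1 ?mulr1 => [|f /andP[_ /negbTE ->]]; ring.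
Qed.

Section Degrees.
Variable n : nat.
Hypotheses (G_loopless : loopless G) (G_regular : regular n G).

Definition sub_degree F (v : G) : nat := @degree (subgraph F) v.

Let edge_at (v u : G) : adj v u -> [set v; u] \in edges G.
Proof. by move=> vu; apply/imsetP; exists (v, u); rewrite ?inE. Qed.

Lemma sub_degreeE F v :
  (sub_degree F v)%:R = \sum_(u | adj v u) ([set v; u] \in F)%:R :> R.
Proof.
rewrite /sub_degree /degree -sum1_card natr_sum big_mkcond [RHS]big_mkcond.
apply: eq_bigr => u _; rewrite !inE /= /subadj.
by case: (adj v u) => //=; case: (_ \in F).
Qed.

Let sum_adj (v : G) (a : R) : \sum_(u | adj v u) a = a *+ n.
Proof. by rewrite sumr_const -(G_regular v) cardsE. Qed.

Lemma sub_degree_centered F v :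
  (sub_degree F v)%:R - n%:R * p = \sum_(u | adj v u) centered [set v; u] F.
Proof. by rewrite sumrB sub_degreeE sum_adj mulr_natl. Qed.

Lemma edge_mean_degree v : edge_mean (fun F => (sub_degree F v)%:R) = n%:R * p.
Proof.
transitivity (edge_mean (fun F =>
    n%:R * p + \sum_(u | adj v u) centered [set v; u] F)).
  by apply: eq_bigr => F _; rewrite -sub_degree_centered; congr (_ * _); ring.
rewrite edge_meanD edge_mean_cst edge_mean_sum big1 ?addr0 // => u vu.
by rewrite edge_mean_centered // edge_at.
Qed.

Lemma edge_mean_degree_var v :
  edge_mean (fun F => ((sub_degree F v)%:R - n%:R * p) ^+ 2) = n%:R * (p * (1 - p)).
Proof.
transitivity (edge_mean (fun F => \sum_(u | adj v u) \sum_(u' | adj v u')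
    centered [set v; u] F * centered [set v; u'] F)).
  by apply: eq_bigr => F _; rewrite sub_degree_centered expr2 big_distrlr.
rewrite edge_mean_sum mulr_natl -(sum_adj v); apply: eq_bigr => u vu.
rewrite edge_mean_sum (bigD1 u) //= edge_mean_centered2 ?edge_at // eqxx mulr1.
rewrite big1 ?addr0 // => u' /andP[vu' ne].
rewrite edge_mean_centered2 ?edge_at // (_ : _ == _ = false) ?mulr0 //.
apply/negbTE; apply: contraNneq ne => /setP/(_ u'); rewrite !inE eqxx orbT.
case/orP => /eqP // u'v; by rewrite u'v G_loopless in vu'.
Qed.

(** Bounding [|x|] by [tau x^2 + tau^-1] makes the variance suffice. *)
Lemma edge_mean_degree_dev v (tau d : R) : 0 < tau -> `|n%:R * p - d| <= 1 ->
  edge_mean (fun F => `|(sub_degree F v)%:R - d|) <= tau * (n%:R * p) + tau^-1 + 1.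
Proof.
move=> tau0 nd; have [p0 p1] := andP p01.
apply: (@le_trans _ _ (edge_mean (fun F =>
    tau * ((sub_degree F v)%:R - n%:R * p) ^+ 2 + (tau^-1 + 1)))).
  apply: le_edge_mean => F; set x := (sub_degree F v)%:R.
  have -> : x - d = (x - n%:R * p) + (n%:R * p - d) by ring.
  apply: le_trans (ler_normD _ _) _; rewrite addrA; apply: lerD nd.
  set y := x - _; rewrite -real_normK ?num_real //; move: (normr_ge0 y) => y0.
  move: `|y| y0 => z z0.
  rewrite -(ler_pM2l tau0).
  have -> : tau * (tau * z ^+ 2 + tau^-1) = (tau * z - 2^-1) ^+ 2 + 3 / 4 + tau * z.
    by field; rewrite gt_eqF.
  by rewrite lerDr addr_ge0 ?sqr_ge0 ?divr_ge0.
rewrite edge_meanD edge_meanZ edge_mean_degree_var edge_mean_cst -addrA lerD2r.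
rewrite ler_wpM2l ?(ltW tau0) // ler_wpM2l // ler_piMr //; lra.
Qed.

End Degrees.
End EdgePercolation.

(** * From tails to the events of the theorem *)

Section DeterministicConcentration.
Variables (R : realType) (H : graph) (lam : H -> R).
Hypotheses (lam_gt0 : forall i, 0 < lam i) (H_edge : has_edge H).

Definition dense_event (eps : R) (G : graph) : bool :=
  [forall k : H,
    (p_prob lam (fun phi : {ffun G -> H} =>
       in_I lam k eps (col_share R k phi)) <= eps) &&
    (p_bar G lam k \in `[a_minus lam k - eps, a_plus lam k + eps])].

Definition sparse_event (eps : R) (G : graph) : bool :=
  [forall k : H,
    (1 - eps <= p_prob lam (fun phi : {ffun G -> H} =>
       `|col_share R k phi - lam k / total_weight lam| <= eps)) &&
    (`|p_bar G lam k - lam k / total_weight lam| <= eps)].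

Lemma Zpart_gt0 (G : graph) (c : G -> bool) : proper c -> 0 < Zpart G lam.
Proof.
have [L _ Z_ge] := sparse_Zpart_ge lam_gt0 H_edge => /Z_ge.
rewrite -(pmulr_lgt0 _ (expR_gt0 (L * \sum_(v : G) (degree v)%:R))).
by apply: lt_le_trans; rewrite exprn_gt0 // total_weight_gt0.
Qed.

Lemma dense_concentration (eps : R) : 0 < eps ->
  exists M : nat, forall (G : graph) (c : G -> bool) (D : nat),
    proper c -> balanced c -> (0 < D)%N -> (M <= #|G|)%N -> (M <= D)%N ->
    M%:R * (\sum_(v : G) `|(degree v)%:R - D%:R|) <= D%:R * #|G|%:R :> R ->
    dense_event eps G.
Proof.
move=> eps0; have eps2 : 0 < eps / 2 by rewrite divr_gt0.
have sqN1 : (-1 : R) ^+ 2 = 1 by rewrite sqrrN expr1n.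
have /fin_all_exists[M1 M1P] k := dense_tail lam_gt0 H_edge (k := k) (sg := 1)
  (a := a_plus lam k) eps2 (expr1n _ 2)
  (fun AB AB_opt => ler_wpM2l ler01 (pair_value_le_a_plus lam_gt0 H_edge k AB_opt)).
have lower_opt k AB : AB \in opt_pairs lam ->
    -1 * pair_value lam k AB <= -1 * (2 * eta lam * a_minus lam k).
  by move=> AB_opt; rewrite !mulN1r lerN2 pair_value_ge_a_minus.
have /fin_all_exists[M2 M2P] k := dense_tail lam_gt0 H_edge (k := k) (sg := -1)
  (a := a_minus lam k) eps2 sqN1 (lower_opt k).
exists (\max_k (M1 k + M2 k))%N => G c D c_proper bal D0 MG MD MDelta.
apply/forallP => k.
have Mk : (M1 k + M2 k <= \max_k (M1 k + M2 k))%N.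
  exact: (leq_bigmax (F := fun k => (M1 k + M2 k)%N)).
have M1k := leq_trans (leq_addr _ _) Mk; have M2k := leq_trans (leq_addl _ _) Mk.
have Delta0 : 0 <= \sum_(v : G) `|(degree v)%:R - D%:R| :> R.
  by apply: sumr_ge0 => v _.
have MDelta' M' : (M' <= \max_k (M1 k + M2 k))%N ->
    M'%:R * (\sum_(v : G) `|(degree v)%:R - D%:R|) <= D%:R * #|G|%:R :> R.
  by move=> le; apply: le_trans MDelta; rewrite ler_wpM2r // ler_nat.
have upper := M1P k G c D c_proper bal D0 (leq_trans M1k MG) (leq_trans M1k MD)
  (MDelta' _ M1k).
have lower := M2P k G c D c_proper bal D0 (leq_trans M2k MG) (leq_trans M2k MD)
  (MDelta' _ M2k).
have Z_gt0 := Zpart_gt0 c_proper.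
have a1 := a_minus_le1 lam_gt0 H_edge k; have b0 := a_plus_ge0 lam_gt0 H_edge k.
have eps_half : 2 * (eps / 2) = eps by field.
apply/andP; split.
  rewrite -[leRHS]eps_half.
  apply: (p_prob_outside_le lam_gt0 Z_gt0 upper lower) => phi.
  rewrite /in_I !in_itv /= => /orP[/andP[_ lt]|/andP[lt _]]; apply/orP.
    by right; apply/ltW/(lt_trans lt); lra.
  by left; apply/ltW/(lt_trans _ lt); lra.
have := p_bar_bounds lam_gt0 Z_gt0 a1 b0 (ltW eps2) upper lower.
by rewrite eps_half in_itv.
Qed.

Lemma sparse_concentration (eps : R) : 0 < eps ->
  exists M : nat, forall (G : graph) (c : G -> bool),
    proper c -> (M <= #|G|)%N ->
    M%:R * (\sum_(v : G) (degree v)%:R) <= #|G|%:R :> R ->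
    sparse_event eps G.
Proof.
move=> eps0; have eps2 : 0 < eps / 2 by rewrite divr_gt0.
have sqN1 : (-1 : R) ^+ 2 = 1 by rewrite sqrrN expr1n.
have /fin_all_exists[M1 M1P] k :=
  sparse_tail lam_gt0 H_edge k eps2 (expr1n _ 2 : (1 : R) ^+ 2 = 1).
have /fin_all_exists[M2 M2P] k :=
  sparse_tail lam_gt0 H_edge k eps2 sqN1.
exists (\max_k (M1 k + M2 k))%N => G c c_proper MG Mdeg.
apply/forallP => k.
have Mk : (M1 k + M2 k <= \max_k (M1 k + M2 k))%N.
  exact: (leq_bigmax (F := fun k => (M1 k + M2 k)%N)).
have M1k := leq_trans (leq_addr _ _) Mk; have M2k := leq_trans (leq_addl _ _) Mk.
have deg0 : 0 <= \sum_(v : G) (degree v)%:R :> R by apply: sumr_ge0 => v _.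
have Mdeg' M' : (M' <= \max_k (M1 k + M2 k))%N ->
    M'%:R * (\sum_(v : G) (degree v)%:R) <= #|G|%:R :> R.
  by move=> le; apply: le_trans Mdeg; rewrite ler_wpM2r // ler_nat.
have upper := M1P k G c c_proper (leq_trans M1k MG) (Mdeg' _ M1k).
have lower := M2P k G c c_proper (leq_trans M2k MG) (Mdeg' _ M2k).
have Z_gt0 := Zpart_gt0 c_proper.
have W_gt0 := total_weight_gt0 lam_gt0 H_edge.
have b0 : 0 <= lam k / total_weight lam by rewrite divr_ge0 // ltW.
have a1 : lam k / total_weight lam <= 1.
  by rewrite ler_pdivrMr // mul1r le_set_weight.
have eps_half : 2 * (eps / 2) = eps by field.
apply/andP; split.
  rewrite -[in leLHS]eps_half.
  apply: (p_prob_inside_ge lam_gt0 Z_gt0 upper lower) => phi /andP[lo hi].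
  by rewrite ler_distl; apply/andP; split; lra.
have := p_bar_bounds lam_gt0 Z_gt0 a1 b0 (ltW eps2) upper lower.
by rewrite eps_half ler_distl.
Qed.

End DeterministicConcentration.

(** * Percolated regular bipartite graphs *)

Section Percolation.
Variables (R : realType) (H : graph) (lam : H -> R).
Hypotheses (lam_gt0 : forall i, 0 < lam i) (H_edge : has_edge H).

Lemma regular_card_ge (G : graph) n : (0 < #|G|)%N -> regular n G -> (n <= #|G|)%N.
Proof. by move=> /card_gt0P[v _] /(_ v) <-; exact: max_card. Qed.

(** With [D] just above the mean degree [n * p], the expected total deviation of
    the degrees from [D] is of order [sqrt D] per vertex, hence negligible
    against [D * #|G|]. *)
Lemma dense_percolation (eps : R) : 0 < eps -> exists T : nat,
  forall (n : nat) (G : graph) (p : R),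
    (0 < #|G|)%N -> loopless G -> bipartite G -> regular n G -> 0 <= p <= 1 ->
    (T <= n)%N -> (0 < n)%N -> T%:R <= n%:R * p ->
  1 - eps <= prob_subgraph G p (dense_event lam eps).
Proof.
move=> eps0; have [M MP] := dense_concentration lam_gt0 H_edge eps0.
have [B B0 MB] : exists2 B : R, 0 < B & M%:R <= B.
  by exists M.+1%:R; rewrite ?ltr0n ?ler_nat.
pose tau := eps / (2 * B); have tau0 : 0 < tau by rewrite divr_gt0 // mulr_gt0.
have [T1 T1P] := nat_upper_bound ((tau^-1 + 1) * (2 * B / eps)).
exists (M + T1)%N => n G p G0 G_loopless [c c_proper] G_reg p01 Tn n0 Tnp.
have [p0 p1] := andP p01.
have np0 : 0 <= n%:R * p by rewrite mulr_ge0.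
pose D := (Num.truncn (n%:R * p)).+1.
have npD : n%:R * p <= D%:R by exact/ltW/truncnS_gt.
have Dnp : D%:R <= n%:R * p + 1 by rewrite /D -natr1 lerD2r truncn_le.
have D0 : 0 < D%:R :> R by rewrite ltr0n.
have TD : (M + T1 <= D)%N by rewrite -(ler_nat R) (le_trans Tnp).
pose X (F : {set {set G}}) : R := \sum_(v : G) `|(sub_degree F v)%:R - D%:R|.
have N0 : 0 < #|G|%:R :> R by rewrite ltr0n.
have t0 : 0 < D%:R * #|G|%:R / B by rewrite divr_gt0 // mulr_gt0.
have good F : X F <= D%:R * #|G|%:R / B -> dense_event lam eps (subgraph F).
  rewrite ler_pdivlMr // => XF.
  apply: (MP (subgraph F) c D) => //.
  - by move=> u v /andP[/c_proper].
  - exact: (regular_balanced c_proper n0 G_reg).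
  - exact: leq_trans (leq_trans (leq_addr _ _) Tn) (regular_card_ge G0 G_reg).
  - exact: leq_trans (leq_addr _ _) TD.
  - rewrite mulrC; apply: le_trans XF; apply: ler_wpM2l => //.
    by apply: sumr_ge0 => v _.
have X0 F : 0 <= X F by apply: sumr_ge0 => v _.
apply: le_trans _ (prob_subgraph_markov p01 t0 X0 good); rewrite lerD2l lerN2.
rewrite ler_pdivrMr // edge_mean_sum.
have dev (v : G) : edge_mean p (fun F => `|(sub_degree F v)%:R - D%:R|)
    <= eps / B * D%:R.
  apply: le_trans (edge_mean_degree_dev (d := D%:R) p01 G_loopless G_reg v tau0 _) _.
    by rewrite ler_norml; apply/andP; split; lra.
  have -> : eps / B * D%:R = tau * D%:R + tau * D%:R.
    by rewrite /tau; field; rewrite lt0r_neq0.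
  rewrite -addrA lerD //; first by rewrite ler_wpM2l // ltW.
  have -> : tau * D%:R = D%:R / (2 * B / eps).
    by rewrite /tau; field; rewrite !lt0r_neq0.
  rewrite ler_pdivlMr ?divr_gt0 ?mulr_gt0 //; apply: le_trans T1P _.
  by rewrite ler_nat (leq_trans (leq_addl _ _) TD).
apply: le_trans (ler_sum _ (fun v _ => dev v)) _.
rewrite sumr_const -[leLHS]mulr_natl le_eqVlt; apply/orP; left; apply/eqP.
by field; rewrite gt_eqF.
Qed.

(** The expected sum of the degrees is [#|G| * (n * p)], negligible against [#|G|]. *)
Lemma sparse_percolation (eps : R) : 0 < eps -> exists T : nat,
  forall (n : nat) (G : graph) (p : R),
    (0 < #|G|)%N -> loopless G -> bipartite G -> regular n G -> 0 <= p <= 1 ->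
    (T <= n)%N -> T%:R * (n%:R * p) <= 1 ->
  1 - eps <= prob_subgraph G p (sparse_event lam eps).
Proof.
move=> eps0; have [M MP] := sparse_concentration lam_gt0 H_edge eps0.
have [B B0 MB] : exists2 B : R, 0 < B & M%:R <= B.
  by exists M.+1%:R; rewrite ?ltr0n ?ler_nat.
have [T1 T1P] := nat_upper_bound (B / eps).
exists (M + T1)%N => n G p G0 G_loopless [c c_proper] G_reg p01 Tn Tnp.
have [p0 p1] := andP p01.
have np0 : 0 <= n%:R * p by rewrite mulr_ge0.
pose X (F : {set {set G}}) : R := \sum_(v : G) (sub_degree F v)%:R.
have N0 : 0 < #|G|%:R :> R by rewrite ltr0n.
have t0 : 0 < #|G|%:R / B by rewrite divr_gt0.
have good F : X F <= #|G|%:R / B -> sparse_event lam eps (subgraph F).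
  rewrite ler_pdivlMr // => XF.
  apply: (MP (subgraph F) c) => //.
  - by move=> u v /andP[/c_proper].
  - exact: leq_trans (leq_trans (leq_addr _ _) Tn) (regular_card_ge G0 G_reg).
  - rewrite mulrC; apply: le_trans XF; apply: ler_wpM2l => //.
    by apply: sumr_ge0 => v _.
have X0 F : 0 <= X F by apply: sumr_ge0 => v _.
apply: le_trans _ (prob_subgraph_markov p01 t0 X0 good); rewrite lerD2l lerN2.
rewrite ler_pdivrMr // edge_mean_sum.
under eq_bigr => v _ do rewrite (edge_mean_degree p G_reg).
have : B / eps * (n%:R * p) <= 1.
  apply: le_trans Tnp; rewrite ler_wpM2r //; apply: le_trans T1P _.
  by rewrite ler_nat leq_addl.
rewrite mulrAC ler_pdivrMr // mul1r => Bnp.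
rewrite sumr_const -[leLHS]mulr_natl [leRHS]mulrCA ler_wpM2l // ler_pdivlMr //.
by rewrite mulrC.
Qed.

End Percolation.

Local Open Scope classical_set_scope.
Local Open Scope ring_scope.

(** Diagonal choice: [g n] is the smallest [1 / (j + 1)] with [j <= n] that is
    admissible at [n]; [j = 0] always is. *)
Lemma vanishing_tolerance (R : realType) (Q : R -> nat -> Prop) :
    (forall n, Q 1 n) ->
    (forall eps, 0 < eps -> exists n0, forall n, (n0 <= n)%N -> Q eps n) ->
  exists g : nat -> R, [/\ forall n, 0 < g n, g n @[n --> \oo] --> (0 : R) &
    forall n, Q (g n) n].
Proof.
move=> Q1 Qev.
pose good n j := `[< Q j.+1%:R^-1 n >].
have good0 n : exists j, (j <= n)%N && good n j.
  by exists 0%N; rewrite /=; apply/asboolP; rewrite invr1.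
pose J n := ex_maxn (good0 n) (fun j (le : (j <= n)%N && good n j) => proj1 (andP le)).
exists (fun n => (J n).+1%:R^-1); split=> [n||n].
- by rewrite invr_gt0 ltr0n.
- apply/cvgrPdist_le => e e0.
  have [j jP] := nat_upper_bound e^-1.
  have [n0 n0P] := Qev j.+1%:R^-1 (ltac:(by rewrite invr_gt0 ltr0n)).
  exists (j + n0)%N => // n /= le_n.
  have jn := leq_trans (leq_addr _ _) le_n.
  have n0n := leq_trans (leq_addl _ _) le_n.
  rewrite sub0r normrN ger0_norm ?invr_ge0 //.
  have jJ : (j <= J n)%N.
    rewrite /J; case: ex_maxnP => i _; apply; rewrite jn /=.
    by apply/asboolP; exact: n0P.
  rewrite -[leRHS]invrK lef_pV2 ?posrE ?invr_gt0 ?ltr0n //.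
  by apply: le_trans jP _; rewrite ler_nat leqW.
- by rewrite /J; case: ex_maxnP => i /andP[_ /asboolP].
Qed.

Theorem corollary1p8 (R : realType) (H : graph) (lam : H -> R)
    (H_edge : has_edge H) (lam_gt0 : forall i : H, 0 < lam i)
    (f : nat -> R) (f_gt0 : forall n : nat, (0 < n)%N -> 0 < f n)
    (f_omega : f n @[n --> \oo] --> +oo) :
  exists g : nat -> R,
    (forall n : nat, (0 < n)%N -> 0 < g n) /\
    (g n @[n --> \oo] --> (0 : R)) /\
    forall (G : nat -> graph) (p : nat -> R),
      (forall n : nat, (0 < n)%N ->
        (0 < #|G n|)%N /\ loopless (G n) /\ bipartite (G n) /\
        regular n (G n) /\ 0 <= p n <= 1) ->
      forall n : nat, (0 < n)%N ->
        (f n / n%:R <= p n ->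
          1 - g n <= prob_subgraph (G n) (p n) (fun Gp : graph =>
            [forall k : H,
              (p_prob lam (fun phi : {ffun Gp -> H} =>
                 in_I lam k (g n) (col_share R k phi)) <= g n) &&
              (p_bar Gp lam k \in
                 `[a_minus lam k - g n, a_plus lam k + g n])])) /\
        (p n <= 1 / (f n * n%:R) ->
          1 - g n <= prob_subgraph (G n) (p n) (fun Gp : graph =>
            [forall k : H,
              (1 - g n <= p_prob lam (fun phi : {ffun Gp -> H} =>
                 `|col_share R k phi - lam k / total_weight lam| <= g n)) &&
              (`|p_bar Gp lam k - lam k / total_weight lam| <= g n)])).
Proof.
pose Q (eps : R) (n : nat) := forall (G : graph) (p : R), (0 < n)%N ->
  (0 < #|G|)%N /\ loopless G /\ bipartite G /\ regular n G /\ 0 <= p <= 1 ->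
  (f n / n%:R <= p -> 1 - eps <= prob_subgraph G p (dense_event lam eps)) /\
  (p <= 1 / (f n * n%:R) -> 1 - eps <= prob_subgraph G p (sparse_event lam eps)).
have [n|eps eps0|g [g0 g_cvg gQ]] := @vanishing_tolerance R Q.
- move=> G p _ [_ [_ [_ [_ p01]]]].
  by split=> _; rewrite subrr; exact: prob_subgraph_ge0.
- have [T1 T1P] := dense_percolation lam_gt0 H_edge eps0.
  have [T2 T2P] := sparse_percolation lam_gt0 H_edge eps0.
  have [N _ fN] : \forall n \near \oo, (T1 + T2)%:R <= f n.
    by move/cvgryPge: f_omega; exact.
  exists (N + (T1 + T2))%N => n nge G p n0 [G0 [Gl [Gb [Gr p01]]]].
  have fn : (T1 + T2)%:R <= f n by apply: fN; rewrite /= (leq_trans (leq_addr _ _) nge).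
  have nR : 0 < n%:R :> R by rewrite ltr0n.
  split=> hp.
  + apply: (T1P n) => //.
      by apply: leq_trans nge; rewrite addnCA leq_addr.
    rewrite ler_pdivrMr // mulrC in hp; apply: le_trans hp.
    by apply: le_trans fn; rewrite ler_nat leq_addr.
  + apply: (T2P n) => //.
      by apply: leq_trans nge; rewrite addnA leq_addl.
    have fn0 := f_gt0 n n0.
    move: hp; rewrite ler_pdivlMr ?mulr_gt0 // => hp.
    have [p0 _] := andP p01.
    have -> : n%:R * p = p * n%:R by rewrite mulrC.
    apply: le_trans hp; rewrite mulrCA ler_wpM2l // ler_wpM2r ?(ltW nR) //.
    by apply: le_trans fn; rewrite ler_nat leq_addl.
- exists g; split=> [n _|]; first exact: g0.
  by split=> // G p GP n n0; apply: gQ => //; exact: GP.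
Qed.
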